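(* Let $(\mathfrak{a},\omega_{\mathfrak{a}})$ denote a Frobenius Lie algebra. (i) $2\in\mathcal{R}(\mathfrak{a},\omega_{\mathfrak{a}})$ for any Frobenius Lie algebra $(\mathfrak{a},\omega_{\mathfrak{a}})$. (ii) $\mathcal{R}(\mathfrak{a},\omega_{\mathfrak{a}})=2\mathbb{N}$ for any Frobenius Lie algebra $(\mathfrak{a},\omega_{\mathfrak{a}})$ with a one-dimensional ideal. (iii) If $k^2<\nu(\mathfrak{a})$ for some integer $k\geq2$, then $2k\notin\mathcal{R}(\mathfrak{a},\omega_{\mathfrak{a}})$.
   Context: All Lie algebras are real and finite-dimensional; $\mathbb{N}=\{1,2,\dots\}$. A Frobenius Lie algebra $(\mathfrak{a},\omega_{\mathfrak{a}})$ is a Lie algebra with an exact symplectic form: a nondegenerate $2$-form $\omega_{\mathfrak{a}}=d\lambda$ for some $\lambda\in\mathfrak{a}^*$, where $d\lambda(x,y)=-\lambda([x,y])$. A contact Lie algebra is a pair $(\mathfrak{g},\eta)$ with $\dim\mathfrak{g}=2n+1$ and $\eta\in\mathfrak{g}^*$ such that $\eta\wedge(d\eta)^n\neq 0$; its Reeb vector is the unique $\xi$ with $\eta(\xi)=1$, $d\eta(\xi,\cdot)=0$. It is DS-contact if $\mathfrak{g}=\mathfrak{t}\oplus\mathfrak{q}$ as vector spaces, where $\mathfrak{t}:=\ker\operatorname{ad}_\xi$ and $\mathfrak{q}:=\operatorname{im}\operatorname{ad}_\xi$. In that case put $\mathfrak{t}_0:=\mathfrak{t}\cap\ker\eta$,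 so $\mathfrak{t}=\mathbb{R}\xi\oplus\mathfrak{t}_0$; $\mathfrak{t}_0$ is a Lie algebra with bracket the $\mathfrak{t}_0$-component of $[\cdot,\cdot]_{\mathfrak{g}}$, and $\omega_{\mathfrak{t}}:=-(d\eta)|_{\mathfrak{t}_0}$ is a symplectic form on it. A Frobenius Lie algebra $(\mathfrak{a},\omega_{\mathfrak{a}})$ is realizable with $\dim\mathfrak{q}=d$ if there is a DS-contact Lie algebra with $\dim\mathfrak{q}=d$ whose $(\mathfrak{t}_0,\omega_{\mathfrak{t}})$ is isomorphic to $(\mathfrak{a},\omega_{\mathfrak{a}})$ (via a Lie algebra isomorphism matching the symplectic forms). Set $\mathcal{R}(\mathfrak{a},\omega_{\mathfrak{a}}):=\{d\in2\mathbb{N}\mid(\mathfrak{a},\omega_{\mathfrak{a}})\text{ is realizable with }\dim\mathfrak{q}=d\}$ and $\nu(\mathfrak{a}):=\min\{\dim J\mid J\text{ is a nonzero ideal in }\mathfrak{a}\}$. *)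

(* Defs.v *)
From HB Require Import structures.
From mathcomp Require Import all_boot all_order all_algebra perm.
From mathcomp Require Import all_classical all_reals.

Set Implicit Arguments.
Unset Strict Implicit.
Unset Printing Implicit Defensive.

Import GRing.Theory.
Local Open Scope ring_scope.
Local Open Scope classical_set_scope.

HB.mixin Record Vector_isLieAlgebra (R : fieldType) (V : Type)
    of Vector R V := {
  lie : V -> V -> V;
  lie_linearl : forall y, linear (lie^~ y);
  lie_linearr : forall x, linear (lie x);
  liexx : forall x, lie x x = 0;
  lie_jacobi : forall x y z,
    lie x (lie y z) + lie y (lie z x) + lie z (lie x y) = 0
}.

#[short(type="lieAlgType")]
HB.structure Definition LieAlgebra (R : fieldType) :=
  {V of Vector R V & Vector_isLieAlgebra R V}.

HB.instance Definition _ (R : fieldType) (g : lieAlgType R) (x : g) :=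
  GRing.isLinear.Build R g g *:%R (lie x) (lie_linearr x).

Section LieAlgebras.
Variables (R : fieldType) (g : lieAlgType R).

Definition ad (x : g) : 'End(g) := linfun (lie x).

Definition is_ideal (J : {vspace g}) : Prop :=
  forall x y : g, y \in J -> lie x y \in J.

Definition nonzero_ideal_dims : set nat :=
  [set \dim J | J in [set J : {vspace g} | is_ideal J /\ J != 0%VS]].

(* The minimum of [nonzero_ideal_dims]. It exists unless g = 0, in which case
   there is no nonzero ideal and [nu] takes the dummy value 0. *)
Definition nu : nat :=
  xget 0%N [set m | nonzero_ideal_dims m /\
                    forall m', nonzero_ideal_dims m' -> (m <= m')%N].

Definition dform1 (l : 'Hom(g, R^o)) (x y : g) : R := - l (lie x y).

Definition nondegenerate2 (w : g -> g -> R) : Prop :=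
  forall x, (forall y, w x y = 0) -> x = 0.

(* Bilinearity and skew-symmetry of w follow from its exactness. *)
Definition frobenius (w : g -> g -> R) : Prop :=
  nondegenerate2 w /\
  exists l : 'Hom(g, R^o), forall x y, w x y = dform1 l x y.

End LieAlgebras.

Section ExteriorForms.
Variables (R : fieldType) (V : vectType R).

(* Exterior k-forms, as functions of k vectors; only the alternating
   multilinear ones are ever considered. *)
Definition kform (k : nat) := ('I_k -> V) -> R.

Definition kform1 (l : 'Hom(V, R^o)) : kform 1 := fun v => l (v ord0).

Definition kform2 (w : V -> V -> R) : kform 2 := fun v => w (v ord0) (v ord_max).

Definition wedge (p q : nat) (a : kform p) (b : kform q) : kform (p + q) :=
  fun v => (p`! * q`!)%:R^-1 *
    \sum_(s : 'S_(p + q)) (-1) ^+ s *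
      (a (fun i => v (s (lshift q i))) * b (fun j => v (s (rshift p j)))).

Fixpoint wedge_pow (w : kform 2) (n : nat) : kform (n * 2) :=
  match n with
  | 0 => fun _ => 1
  | n'.+1 => wedge w (@wedge_pow w n')
  end.

End ExteriorForms.
Arguments wedge_pow {R V} w n _.

Section Contact.
Variables (R : fieldType) (g : lieAlgType R).
Implicit Types (eta : 'Hom(g, R^o)) (xi : g).

Definition contact eta : Prop :=
  exists n : nat, \dim {:g} = (2 * n + 1)%N /\
    exists v, wedge (kform1 eta) (wedge_pow (kform2 (dform1 eta)) n) v != 0.

Definition is_reeb eta xi : Prop :=
  eta xi = 1 /\ forall y, dform1 eta xi y = 0.

Definition tspace xi : {vspace g} := lker (ad xi).
Definition qspace xi : {vspace g} := limg (ad xi).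

Definition ds_contact eta xi : Prop :=
  [/\ contact eta, is_reeb eta xi,
      (tspace xi + qspace xi)%VS = fullv & directv (tspace xi + qspace xi)].

Definition t0space eta xi : {vspace g} := (tspace xi :&: lker eta)%VS.

(* The t0-component of the bracket in the decomposition t = R xi (+) t0. *)
Definition t0_lie eta xi (x y : subvs_of (t0space eta xi)) :
    subvs_of (t0space eta xi) :=
  vsproj (t0space eta xi)
    (daddv_pi (t0space eta xi) <[xi]> (lie (vsval x) (vsval y))).

Definition omega_t eta xi (x y : subvs_of (t0space eta xi)) : R :=
  - dform1 eta (vsval x) (vsval y).

End Contact.

Section Realizability.
Variables (R : fieldType) (a : lieAlgType R) (w : a -> a -> R).

Definition realizable (d : nat) : Prop :=
  exists (g : lieAlgType R) (eta : 'Hom(g, R^o)) (xi : g),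
    [/\ ds_contact eta xi, \dim (qspace xi) = d &
      exists f : 'Hom(a, subvs_of (t0space eta xi)),
        [/\ bijective f,
            forall x y, f (lie x y) = t0_lie (f x) (f y) &
            forall x y, omega_t (f x) (f y) = w x y]].

Definition even_pos : set nat := [set d | exists2 n, (0 < n)%N & d = (2 * n)%N].

Definition realizable_dims : set nat := [set d | even_pos d /\ realizable d].

End Realizability.

(* Main.v *)
From HB Require Import structures.
Require Import Defs.
From mathcomp Require Import all_boot all_order all_algebra perm spectral.
From mathcomp Require Import complex.
From mathcomp Require Import all_classical all_reals.
From mathcomp Require Import ring zify.

Set Implicit Arguments.
Unset Strict Implicit.
Unset Printing Implicit Defensive.

Import Order.TTheory GRing.Theory Num.Theory VectorInternalTheory.
Local Open Scope ring_scope.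

(** The two halves of the proposition rest on the same picture.  Let (g, eta)
    be DS-contact with Reeb vector xi, and identify t_0 with a.  On t_0 one has
    eta([x, y]) = w(x, y), so t is the extension of a by R xi with cocycle w.
    Elements of t commute with xi, hence preserve q; so a acts on q by operators
    commuting with the invertible operator ad xi, and what remains of the structure of g is
    the bracket of two elements of q.

    The contact condition is a volume condition, but only its linear-algebra
    content is ever needed: eta is contact with Reeb vector xi if and only if
    ker eta meets the radical of d eta trivially.  One direction
    ([contact_nondegenerate]) holds because a form of top degree killed by a
    nonzero vector vanishes; the other ([nondegenerate_contact]) evaluates the
    form on a Darboux basis.

    Realizations.  Take q = R^k + R^k with its standard symplectic form psi, let
    xi act by 1 on the first summand and by -1 on the second, let a act on q by
    half of a character chi, and put [u, v] = psi(u, v) (z + c xi) for u, v in q,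
    where z in a satisfies [x, z] = chi(x) z.  The Jacobi identity asks, besides
    compatibility of chi, z and c, that the cyclic sum of c psi(u, v) [xi, w]
    vanish, which is true if c = 0 or if q is a plane.  With eta = xi^* - lambda
    the result is DS-contact as soon as c <> lambda(z) ([ext_realizable]).
    For chi = 0, z = 0, c = 1, k = 1 it is the direct product of a with sl_2,
    which realizes every a with dim q = 2.  If a has a one-dimensional ideal, let z
    span it, let chi be its weight and c = 0: then q + R z is a Heisenberg algebra,
    lambda(z) <> 0 because w is nondegenerate, and k is arbitrary.

    Obstruction.  Let P be the projection of g onto a along R xi + q.  The
    vectors P [u, v] with u, v in q span an ideal J of a.  From
    w(x, P [u, v]) = eta([x, [u, v]]) and the nondegeneracy of w, dim J is at most
    the dimension of a space of skew forms on q invariant under ad xi.  Over C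
    such a form pairs the generalized eigenspace of r with that of -r, and
    0 is not an eigenvalue, so for dim q = 2k this dimension is at most k^2
    ([skew_invariant_dim]).  If k^2 < nu(a) then J = 0, so R xi + q is a
    subalgebra: a contact Lie algebra in which the centralizer of the Reeb
    vector is a line.  Over C it behaves like a semisimple algebra of rank one,
    and the theory of sl_2-triples, started from an eigenvalue of ad xi of
    largest modulus, shows that its dimension is at most 3 ([rank_one_dim]).
    Hence k <= 1. *)

(** * Lie brackets *)

Section LieTheory.
Variables (F : fieldType) (g : lieAlgType F).
Implicit Types x y z : g.

Definition lier y x := lie x y.

HB.instance Definition _ (y : g) :=
  GRing.isLinear.Build F g g *:%R (lier y) (lie_linearl y).

Lemma lieDl x y z : lie (x + y) z = lie x z + lie y z.
Proof. exact: (linearD (lier z)). Qed.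
Lemma lieDr x y z : lie z (x + y) = lie z x + lie z y.
Proof. exact: linearD. Qed.
Lemma lieC x y : lie x y = - lie y x.
Proof.
have := liexx (x + y).
rewrite lieDr !lieDl !liexx add0r addr0.
by move/eqP; rewrite addrC addr_eq0 => /eqP.
Qed.

Lemma lieZl c x z : lie (c *: x) z = c *: lie x z.
Proof. exact: (linearZ_LR (lier z)). Qed.
Lemma lieZr c x z : lie z (c *: x) = c *: lie z x.
Proof. exact: linearZ_LR. Qed.
Lemma lieNl x z : lie (- x) z = - lie x z.
Proof. exact: (linearN (lier z)). Qed.
Lemma lieNr x z : lie z (- x) = - lie z x.
Proof. exact: linearN. Qed.
Lemma lie0l z : lie 0 z = 0 :> g.
Proof. exact: (linear0 (lier z)). Qed.
Lemma lie0r z : lie z 0 = 0 :> g.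
Proof. exact: linear0. Qed.

Lemma lie_suml (I : finType) (f : I -> g) z :
  lie (\sum_i f i) z = \sum_i lie (f i) z.
Proof. exact: (linear_sum (lier z)). Qed.
Lemma lie_sumr (I : finType) (f : I -> g) z :
  lie z (\sum_i f i) = \sum_i lie z (f i).
Proof. exact: linear_sum. Qed.

Lemma lie_leibniz x y z : lie x (lie y z) = lie (lie x y) z + lie y (lie x z).
Proof.
have /eqP := lie_jacobi x y z.
rewrite -addrA addr_eq0 => /eqP ->; rewrite opprD addrC.
by rewrite (lieC (lie x y)) (lieC x z) lieNr.
Qed.

End LieTheory.

(** * Eigenvectors over an algebraically closed field *)

(** The Cayley-Hamilton theorem with the characteristic polynomial split into
    linear factors.  Working with such a product, applied factor by factor, is a
    substitute for generalized eigenspace decompositions. *)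
Lemma mx_annihilating_product (F : closedFieldType) n (M : 'M[F]_n) :
  exists rs : seq F, forall v : 'rV_n,
    foldr (fun r u => u *m M - r *: u) v rs = 0.
Proof.
case: n M => [|n] M; first by exists [::] => v; rewrite thinmx0.
have [rs] := closed_field_poly_normal (char_poly M).
rewrite (monicP (char_poly_monic M)) scale1r => char_rs.
exists rs => v.
suff -> : foldr (fun r u => u *m M - r *: u) v rs =
          v *m horner_mx M (\prod_(r <- rs) ('X - r%:P)).
  by rewrite -char_rs Cayley_Hamilton mulmx0.
elim: (rs) => [|r s IH] /=; first by rewrite big_nil rmorph1 mulmx1.
rewrite big_cons mulrC rmorphM rmorphB /= horner_mx_X horner_mx_C IH.
by rewrite -mulmxE mulmxA mulmxBr mul_mx_scalar.
Qed.

Section AnnihilatingProduct.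
Variables (F : closedFieldType) (V : vectType F) (f : {linear V -> V}).
Implicit Types (rs : seq F) (u v : V) (U : {vspace V}).

Definition shift_prod rs v := foldr (fun r u => f u - r *: u) v rs.

Lemma annihilating_product : exists rs, forall v, shift_prod rs v = 0.
Proof.
have [rs rs0] := mx_annihilating_product (lin1_mx (v2r \o f \o r2v)).
exists rs => v; apply: v2r_inj; rewrite linear0 -[RHS](rs0 (v2r v)).
elim: (rs) => [|r s IH] //=.
by rewrite linearB linearZ /= -IH mul_rV_lin1 /= v2rK.
Qed.

Lemma shift_prod_eigen rs a v : f v = a *: v ->
  shift_prod rs v = (\prod_(r <- rs) (a - r)) *: v.
Proof.
move=> fv; elim: rs => [|r s IH] /=; first by rewrite big_nil scale1r.
by rewrite big_cons IH linearZ /= fv !scalerA -scalerBl; congr (_ *: _); ring.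
Qed.

Lemma eigenvalue_in rs : (forall v, shift_prod rs v = 0) ->
  forall a v, v != 0 -> f v = a *: v -> a \in rs.
Proof.
move=> rs0 a v v0 fv; have /eqP := rs0 v.
rewrite (shift_prod_eigen _ fv) scaler_eq0 (negPf v0) orbF.
elim: rs {rs0} => [|r s IH]; first by rewrite big_nil oner_eq0.
rewrite big_cons mulf_eq0 subr_eq0 inE => /orP[->//|/IH->].
by rewrite orbT.
Qed.

(** When the factors are applied one at a time to a nonzero vector of U, the
    last nonzero vector obtained is an eigenvector. *)
Lemma invariant_eigenvector U : U != 0%VS ->
  (forall v, v \in U -> f v \in U) ->
  exists a v, [/\ v \in U, v != 0 & f v = a *: v].
Proof.
move=> U0 fU; have [rs rs0] := annihilating_product.
have := rs0 (vpick U); have := memv_pick U; have : vpick U != 0 by rewrite vpick0.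
move: (vpick U) => v v0 vU.
elim: rs {rs0} => [|r s IH] /=; first by move/eqP; rewrite (negPf v0).
have sU : shift_prod s v \in U.
  by elim: (s) => //= b t tU; rewrite memvB ?memvZ ?fU.
have [/IH//|s0 /eqP] := eqVneq (shift_prod s v) 0.
by rewrite subr_eq0 => /eqP Es; exists r, (shift_prod s v).
Qed.

Lemma factorsC a r v :
  f (f v - a *: v) - r *: (f v - a *: v) = f (f v - r *: v) - a *: (f v - r *: v).
Proof.
rewrite !linearB [f (a *: v)]linearZ [f (r *: v)]linearZ /= !scalerA (mulrC r).
by rewrite !opprK !addrA [f (f v) - _ - _]addrAC.
Qed.

(** If l is a left eigenvector of f for a, each factor f - r with r <> a
    multiplies l by a nonzero scalar; so those factors send a vector where l does
    not vanish to another one, which is killed by the remaining factors f - a. *)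
Lemma generalized_eigenvector a (l : {linear V -> F^o}) :
  (forall v, l (f v) = a * l v) -> (exists v, l v != 0) ->
  exists m w, iter m (fun v => f v - a *: v) w = 0 /\ l w = 1.
Proof.
move=> lf [z lz]; have [rs rs0] := annihilating_product.
pose s := [seq r <- rs | r != a].
have ls : l (shift_prod s z) != 0.
  rewrite /s; elim: (rs) => //= r t IH.
  case: ifP => //= ra; rewrite linearB linearZ /= lf -mulrBl mulf_neq0 //.
  by rewrite subr_eq0 eq_sym ra.
exists (count (pred1 a) rs), ((l (shift_prod s z))^-1 *: shift_prod s z); split; last first.
  by rewrite linearZ; exact: mulVf.
have itZ m c v : iter m (fun v => f v - a *: v) (c *: v) =
                 c *: iter m (fun v => f v - a *: v) v.
  by elim: m => //= m ->; rewrite linearZ /= scalerBr !scalerA mulrC.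
rewrite itZ; suff -> : iter (count (pred1 a) rs) (fun v => f v - a *: v) (shift_prod s z)
   = shift_prod rs z by rewrite rs0 scaler0.
rewrite /s; elim: (rs) => //= r t IH; case: eqP => [->|_] /=.
  by rewrite IH.
rewrite -IH; elim: (count _ _) => //= m ->.
exact: factorsC.
Qed.

End AnnihilatingProduct.

(** * Contact Lie algebras of rank one over a closed field *)

Lemma exists_max_norm (C : numFieldType) (s : seq C) (P : C -> Prop) :
  (exists2 a, a \in s & P a) ->
  exists a, P a /\ forall b, b \in s -> P b -> `|b| <= `|a|.
Proof.
elim: s => [[]//|c s IH [a as0 Pa]].
have [[a' a's Pa']|nP] := pselect (exists2 a, a \in s & P a); last first.
  exists c; split => [|b].
    move: as0; rewrite inE => /orP[/eqP <-//|as0]; case: nP; by exists a.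
  by rewrite inE => /orP[/eqP->//|bs Pb]; case: nP; exists b.
have [|m [Pm mmax]] := IH; first by exists a'.
have [Pc|nPc] := pselect (P c); last first.
  by exists m; split => // b; rewrite inE => /orP[/eqP->//|]; last exact: mmax.
have [lecm|/ltW lemc] := real_leP (normr_real c) (normr_real m).
  exists m; split=> // b; rewrite inE => /orP[/eqP->//|]; exact: mmax.
exists c; split=> // b; rewrite inE => /orP[/eqP->//|bs Pb].
exact: le_trans (mmax _ bs Pb) lemc.
Qed.

(** By the parallelogram identity,
    2 |b|^2 + 2 |a|^2 = |b + a|^2 + |b - a|^2 <= 2 |a|^2.  This limits the strings
    of eigenvalues in the direction of an eigenvalue of largest modulus. *)
Lemma norm_parallelogram (C : numClosedFieldType) (a b : C) :
  `|b + a| <= `|a| -> `|b - a| <= `|a| -> b = 0.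
Proof.
have sq (x : C) : `|x| <= `|a| -> x * x^* <= a * a^*.
  by rewrite -!normCK => h; rewrite lerXn2r ?nnegrE ?normr_ge0.
move=> /sq h1 /sq h2; have := lerD h1 h2.
have -> : (b + a) * (b + a)^* + (b - a) * (b - a)^* =
   2 * (b * b^*) + (a * a^* + a * a^*) by rewrite rmorphD rmorphB /=; ring.
rewrite gerDr pmulr_rle0 // -normCK => h.
by apply/eqP; rewrite -normr_eq0 -sqrf_eq0 eq_le h exprn_ge0.
Qed.

Section RankOne.
Variables (C : numClosedFieldType) (L : lieAlgType C).
Variables (eta : 'Hom(L, C^o)) (xi : L).
Hypothesis eta_xi : eta xi = 1.
Hypothesis eta_lie_xi : forall y, eta (lie xi y) = 0.
Hypothesis ker_xi : forall x, lie xi x = 0 -> x = eta x *: xi.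
Hypothesis rad_eta : forall x, (forall y, eta (lie x y) = 0) -> x = eta x *: xi.

Definition eigvec (a : C) (v : L) := lie xi v = a *: v.

Lemma eigvec_lie a b x y : eigvec a x -> eigvec b y -> eigvec (a + b) (lie x y).
Proof. by move=> ax bx; rewrite /eigvec lie_leibniz ax bx lieZl lieZr scalerDl. Qed.

(** The image of ad xi lies in ker eta, which meets the kernel of ad xi
    trivially, so that 0 is a semisimple eigenvalue. *)
Lemma iter_ker_xi m y : iter m (lie xi) y = 0 -> y = eta y *: xi.
Proof.
elim: m y => [y /= ->|m IH y]; first by rewrite linear0 scale0r.
rewrite iterSr => /IH; rewrite eta_lie_xi scale0r; exact: ker_xi.
Qed.

Lemma eigvec_eta a v : a != 0 -> eigvec a v -> eta v = 0.
Proof.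
move=> a0 /(congr1 eta); rewrite eta_lie_xi linearZ /= => /esym/eqP.
by rewrite mulf_eq0 (negPf a0) => /eqP.
Qed.

(** The functional eta([u, -]) is a nonzero left eigenvector of ad xi for -a,
    hence does not vanish on the generalized eigenspace of -a.  For w there,
    [u, w] lies in the generalized eigenspace of 0, that is, on the line of xi. *)
Lemma eigvec_dual a u : a != 0 -> u != 0 -> eigvec a u ->
  exists m w, iter m (fun v => lie xi v - (- a) *: v) w = 0 /\ lie u w = xi.
Proof.
move=> a0 u0 eu.
pose l : {linear L -> C^o} := eta \o lie u.
have [v||m [w [mw lw]]] := @generalized_eigenvector _ _ (lie xi) (- a) l.
- rewrite /l /=; have := eta_lie_xi (lie u v).
  rewrite lie_leibniz eu lieZl linearD linearZ /= => /eqP.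
  by rewrite addrC addr_eq0 mulNr => /eqP.
- apply: contrapT => nl; move: u0; rewrite (@rad_eta u) => [|y].
    by rewrite (eigvec_eta a0 eu) scale0r eqxx.
  by apply/eqP; apply: contrapT => h; apply: nl; exists y; apply/negP.
exists m, w; split => //.
rewrite (@iter_ker_xi m (lie u w)) ?[eta _]lw ?scale1r //.
suff -> : iter m (lie xi) (lie u w) =
          lie u (iter m (fun v => lie xi v - - a *: v) w) by rewrite mw lie0r.
elim: (m) => //= k ->; rewrite lie_leibniz eu lieZl linearB /= lieZr.
by rewrite scaleNr opprK addrC.
Qed.

Definition max_eigval (a : C) :=
  forall b v, v != 0 -> eigvec b v -> `|b| <= `|a|.

Lemma eigvec_big a b v : max_eigval a -> ~ (`|b| <= `|a|) -> eigvec b v -> v = 0.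
Proof.
by move=> amax ba bv; apply/eqP; apply: contrapT => /negP v0; case: ba; exact: amax bv.
Qed.

Lemma generalized_big a b m v : max_eigval a -> ~ (`|b| <= `|a|) ->
  iter m (fun v => lie xi v - b *: v) v = 0 -> v = 0.
Proof.
move=> amax ba; elim: m => //= m IH /eqP; rewrite subr_eq0 => /eqP h.
exact/IH/(eigvec_big amax ba).
Qed.

Lemma norm_mulrn_big (a : C) n : a != 0 -> (1 < n)%N -> ~ (`|a *+ n| <= `|a|).
Proof.
move=> a0 n1; rewrite normrMn => /(lt_le_trans _) => /(_ `|a|).
rewrite ltxx => h; suff : false by []; apply: h.
by rewrite -[X in X < _]mulr1n ltr_pMn2l // normr_gt0.
Qed.

(** Suppose that w is not an eigenvector and let w1 be the last nonzero vector
    among the (ad xi + a)^i w.  Then [u, w1] = 0, and [w1, w] = 0 because -2a has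
    too large a modulus; bracketing the latter with u gives [w1, xi] = 0, absurd. *)
Lemma max_eigvec_dual a u : a != 0 -> max_eigval a -> u != 0 -> eigvec a u ->
  exists2 w, eigvec (- a) w & lie u w = xi.
Proof.
move=> a0 amax u0 eu; have [m [w [mw uw]]] := eigvec_dual a0 u0 eu.
exists w => //; have w0 : w <> 0.
  by move=> w0; move: eta_xi; rewrite -uw w0 lie0r linear0 => /eqP; rewrite eq_sym oner_eq0.
pose A v := lie xi v - - a *: v.
(* The last nonzero iterate of ad xi + a at w. *)
have [k [kw kw1]] : exists k, iter k A w <> 0 /\ iter k.+1 A w = 0.
  elim: m mw => // m IH; have [/IH//|/eqP mn0] := eqVneq (iter m A w) 0.
  by move=> mw; exists m.
case: k => [|k] in kw kw1.
  by apply/eqP; rewrite -subr_eq0; apply/eqP.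
case: kw; set w1 := iter k.+1 A w.
have ew1 : eigvec (- a) w1.
  by apply/eqP; rewrite -subr_eq0; apply/eqP; exact: kw1.
have uw1 : lie u w1 = 0.
  have uA v : lie u (A v) = lie xi (lie u v).
    by rewrite lie_leibniz eu lieZl linearB /= lieZr scaleNr opprK addrC.
  by rewrite /w1 iterSr; elim: (k) => [|j IH] /=; rewrite uA ?IH ?uw ?liexx ?lie0r.
have w1w : lie w1 w = 0.
  apply: (@generalized_big a (- a *+ 2) k.+2) => //.
    by rewrite mulNrn normrN; apply: norm_mulrn_big.
  suff -> : iter k.+2 (fun v => lie xi v - (- a *+ 2) *: v) (lie w1 w) =
            lie w1 (iter k.+2 A w) by rewrite kw1 lie0r.
  elim: (k.+2) => //= j ->; rewrite lie_leibniz ew1 lieZl linearB /= lieZr.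
  by rewrite mulr2n scalerDl opprD addrACA subrr add0r.
have := lie_leibniz u w1 w; rewrite w1w lie0r uw1 lie0l add0r uw lieC ew1.
move/esym/eqP; rewrite oppr_eq0 scaler_eq0 oppr_eq0 (negPf a0) => /eqP; exact.
Qed.

(** An sl_2-triple, up to scaling xi. *)
Definition triple a u w := [/\ eigvec a u, eigvec (- a) w & lie u w = xi].

Lemma triple_sym a u w : triple a u w -> triple (- a) w (- u).
Proof.
case=> eu ew uw; split => //; last by rewrite lieNr lieC opprK.
by rewrite /eigvec opprK lieNr eu scalerN.
Qed.

Lemma max_eigvalN a : max_eigval a -> max_eigval (- a).
Proof. by move=> h b v v0 bv; rewrite normrN; exact: h bv. Qed.

Lemma xi_neq0 : xi != 0.
Proof. by apply/eqP => h; move: eta_xi; rewrite h linear0 => /eqP; rewrite eq_sym oner_eq0. Qed.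

Lemma eigvec0 v : eigvec 0 v -> v = eta v *: xi.
Proof. by rewrite /eigvec scale0r => /ker_xi. Qed.

(** After subtracting a multiple of u one may assume [v, w] = 0, while
    [u, v] = 0 for reasons of modulus; then [v, xi] = [v, [u, w]] = 0. *)
Lemma top_eigvec a u w v : a != 0 -> max_eigval a -> triple a u w ->
  eigvec a v -> v = eta (lie v w) *: u.
Proof.
move=> a0 amax [eu ew uw] ev; apply/eqP; rewrite -subr_eq0.
set c := eta _; set v' := v - _.
have ev' : eigvec a v'.
  by rewrite /eigvec lieDr lieNr lieZr ev eu scalerBr !scalerA mulrC.
have v'w : lie v' w = 0.
  rewrite (@eigvec0 (lie v' w)); last by rewrite -(subrr a); exact: eigvec_lie.
  rewrite /v' lieDl lieNl lieZl uw linearB linearZ /= eta_xi -/c.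
  by rewrite [_ *: 1]mulr1 subrr scale0r.
have uv' : lie u v' = 0.
  apply: (@eigvec_big a (a *+ 2)) => //; first exact: norm_mulrn_big.
  by rewrite mulr2n; exact: eigvec_lie.
have := lie_leibniz u v' w; rewrite v'w lie0r uv' lie0l add0r uw lieC ev'.
by move/esym/eqP; rewrite oppr_eq0 scaler_eq0 (negPf a0).
Qed.

(** The vector v is a lowest weight vector whose string has length at most 2,
    since b + 2a has too large a modulus: [u, [u, v]] = 0.  Applying [w, -] to that
    equation gives 2b = -a, the weights of the two-dimensional sl_2-module. *)
Lemma lowest_eigval (a : C) (u w : L) (b : C) (v : L) : max_eigval a -> triple a u w ->
  b != 0 -> b != - a -> v != 0 -> eigvec b v -> ~ (`|b - a| <= `|a|) ->
  b *+ 2 = - a.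
Proof.
move=> amax [eu ew uw] b0 bNa v0 ev big.
have wv : lie w v = 0.
  by apply: eigvec_big big _; rewrite // addrC; exact: eigvec_lie.
have ey := eigvec_lie eu ev; set y := lie u v in ey.
have uy : lie u y = 0.
  apply: (eigvec_big amax _ (eigvec_lie eu ey)) => h.
  case/eqP: bNa; apply/eqP; rewrite -addr_eq0; apply/eqP.
  apply: (@norm_parallelogram _ a); first by rewrite addrC [b + a]addrC.
  by rewrite addrK; exact: amax ev.
have wu : lie w u = - xi by rewrite lieC uw.
have wy : lie w y = - (b *: v).
  by rewrite lie_leibniz wu wv lie0r addr0 lieNl ev.
have y0 : y != 0.
  apply/eqP => y0; move/eqP: wy; rewrite y0 lie0r eq_sym oppr_eq0.
  by rewrite scaler_eq0 (negPf b0) (negPf v0).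
have := lie_leibniz w u y; rewrite uy lie0r wu wy lieNl ey lieNr lieZr -/y.
rewrite -opprD -scalerDl => /esym/eqP; rewrite oppr_eq0 scaler_eq0 (negPf y0) orbF.
by rewrite mulr2n -addrA addrC addr_eq0 => /eqP.
Qed.

(** An eigenvector v for b = a/2 is the start of another triple, with some w'
    in the generalized eigenspace of -b.  For it w has the weight of a five
    dimensional sl_2-module, whose zero weight vector [v, [v, w]] is a multiple of
    xi = [v, w'].  But xi belongs to the three dimensional module of the triple
    itself, which is contradictory. *)
Lemma no_half_eigval (a : C) (u w : L) (b : C) (v : L) : max_eigval a -> triple a u w -> b != 0 ->
  b *+ 2 = a -> v != 0 -> eigvec b v -> False.
Proof.
move=> amax [eu ew uw] b0 b2 v0 ev.
have [m [w' [mw' vw']]] := eigvec_dual b0 v0 ev.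
have ww' : lie w w' = 0.
  apply: (@generalized_big a (- b *+ 3) m) => //.
    rewrite -b2 !normrMn normrN ler_pMn2l // normr_gt0 //.
  suff -> : iter m (fun v => lie xi v - (- b *+ 3) *: v) (lie w w') =
            lie w (iter m (fun v => lie xi v - - b *: v) w') by rewrite mw' lie0r.
  elim: (m) => //= j ->; rewrite lie_leibniz ew lieZl linearB /= lieZr -b2.
  by rewrite addrAC -scalerBl addrC; congr (_ + _); rewrite -scaleNr; congr (_ *: _); ring.
have w'v : lie w' v = - xi by rewrite lieC vw'.
have ey := eigvec_lie ev ew; set y := lie v w in ey.
have {}ey : eigvec (- b) y by rewrite -[- b](_ : b - a = _) // -b2; ring.
have w'y : lie w' y = a *: w.
  rewrite lie_leibniz w'v (lieC w' w) ww' oppr0 lie0r addr0 lieNl ew.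
  by rewrite scaleNr opprK.
have vy : lie v y = eta (lie v y) *: xi.
  by apply: eigvec0; rewrite -(subrr b); exact: eigvec_lie.
set c := eta _ in vy.
have e1 : (b *+ 3) *: y = - c *: lie xi w'.
  have := lie_leibniz w' v y; rewrite vy w'v w'y lieZr lieNl ey lieZr -/y.
  rewrite -scaleNr -scalerDl (lieC w') scalerN -scaleNr => ->.
  by congr (_ *: _); rewrite -b2; ring.
have vDw' : lie v (lie xi w') = - (b *: xi).
  have := lie_leibniz xi v w'; rewrite vw' liexx ev lieZl vw' => /esym/eqP.
  by rewrite addrC addr_eq0 => /eqP.
have c0 : c = 0.
  have := congr1 (lie v) e1; rewrite !lieZr vy vDw' scalerA scalerN -scaleNr opprK.
  rewrite scalerA => /eqP; rewrite -subr_eq0 -scalerBl scaler_eq0 (negPf xi_neq0).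
  rewrite orbF (_ : _ - _ = b * c *+ 2); last by ring.
  by rewrite mulrn_eq0 /= mulf_eq0 (negPf b0) => /eqP.
have y0 : y = 0.
  move/eqP: e1; rewrite c0 oppr0 scale0r scaler_eq0 mulrn_eq0 /= (negPf b0).
  by move/eqP.
move/eqP: w'y; rewrite y0 lie0r eq_sym scaler_eq0 -b2 mulrn_eq0 (negPf b0) /=.
by move/eqP => w0; case/eqP: xi_neq0; rewrite -uw w0 lie0r.
Qed.

Lemma eigvals (a : C) (u w : L) (b : C) (v : L) : max_eigval a -> triple a u w ->
  b != 0 -> v != 0 -> eigvec b v -> b = a \/ b = - a.
Proof.
move=> amax t b0 v0 ev.
have [->|ba] := eqVneq b a; first by left.
have [->|bNa] := eqVneq b (- a); first by right.
have amaxN := max_eigvalN amax; have tN := triple_sym t.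
have [h1|h1] := pselect (`|b - a| <= `|a|); last first.
  case: (no_half_eigval amaxN tN b0 _ v0 ev).
  exact: lowest_eigval amax t b0 bNa v0 ev h1.
case: (no_half_eigval amax t b0 _ v0 ev); rewrite -[RHS]opprK.
apply: (lowest_eigval amaxN tN b0 _ v0 ev); rewrite !opprK //.
by rewrite normrN => h2; case/eqP: b0; exact: norm_parallelogram h2 h1.
Qed.

End RankOne.

Lemma dim_cap_lker (F : fieldType) (V : vectType F) (U : {vspace V})
  (f : 'Hom(V, F^o)) : (\dim U <= (\dim (U :&: lker f)).+1)%N.
Proof.
rewrite -(limg_ker_dim f U) -addn1 leq_add2l.
by apply: leq_trans (dimvS (subvf _)) _; rewrite dimvf.
Qed.

(** Once a is an eigenvalue of largest modulus, with triple u, w, the only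
    other nonzero eigenvalue is -a, and both eigenspaces are lines.  The common
    kernel of eta, eta([u, -]) and eta([w, -]) is stable under ad xi and contains no
    eigenvector, so it is zero; the three functionals bound the dimension. *)
Lemma rank_one_dim (C : numClosedFieldType) (L : lieAlgType C)
    (eta : 'Hom(L, C^o)) (xi : L) :
  eta xi = 1 -> (forall y, eta (lie xi y) = 0) ->
  (forall x, lie xi x = 0 -> x = eta x *: xi) ->
  (forall x, (forall y, eta (lie x y) = 0) -> x = eta x *: xi) ->
  (\dim {:L} <= 3)%N.
Proof.
move=> e1 e2 e3 e4; pose K := lker eta.
have etaP x : (x \in K) = (eta x == 0) by rewrite memv_ker.
have nz U : (U <= K)%VS -> U != 0%VS -> (forall v, v \in U -> lie xi v \in U) ->
    exists b v, [/\ b != 0, v \in U, v != 0 & lie xi v = b *: v].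
  move=> /subvP UK U0 /(invariant_eigenvector U0) [b [v [vU v0 bv]]].
  exists b, v; split => //; apply/eqP => b0.
  move: (bv); rewrite b0 scale0r => /e3 vE; move: v0; rewrite vE.
  by have := UK _ vU; rewrite etaP => /eqP->; rewrite scale0r eqxx.
have [K0|K0] := eqVneq K 0%VS.
  by apply: leq_trans (dim_cap_lker _ eta) _; rewrite capfv -/K K0 dimv0.
have [|b0 [v0 [b0N0 _ v0N0 bv0]]] := nz K (subvv _) K0.
  by move=> v _; rewrite etaP e2.
have [rs rs0] := annihilating_product (lie xi).
have rsP := eigenvalue_in rs0.
have [|a [[u u0 eu] amax']] :=
    @exists_max_norm _ rs (fun b => exists2 v, v != 0 & lie xi v = b *: v).
  by exists b0; [exact: rsP bv0 | exists v0].
have amax : max_eigval xi a.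
  by move=> b v vN0 bv; apply: amax'; [exact: rsP bv | exists v].
have a0 : a != 0.
  apply/eqP => a0; move: (amax _ _ v0N0 bv0); rewrite a0 normr0 normr_le0.
  exact/negP.
have [w ew uw] := max_eigvec_dual e1 e2 e3 e4 a0 amax u0 eu.
have t : triple xi a u w by [].
pose lu : 'Hom(L, C^o) := linfun (eta \o lie u).
pose lw : 'Hom(L, C^o) := linfun (eta \o lie w).
have luE v : lu v = eta (lie u v) by rewrite lfunE.
have lwE v : lw v = eta (lie w v) by rewrite lfunE.
suff Q0 : (K :&: lker lu :&: lker lw = 0)%VS.
  apply: leq_trans (dim_cap_lker _ eta) _; rewrite capfv -/K ltnS.
  apply: leq_trans (dim_cap_lker _ lu) _; rewrite ltnS.
  by apply: leq_trans (dim_cap_lker _ lw) _; rewrite Q0 dimv0.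
apply/eqP; apply: contrapT => /negP Q0.
have eDl c x v : lie xi x = c *: x -> eta (lie x v) = 0 -> eta (lie x (lie xi v)) = 0.
  move=> ex exv; have := e2 (lie x v).
  by rewrite lie_leibniz ex lieZl linearD linearZ /= exv scaler0 add0r.
have [||b [v [bN0 vQ vN0 bv]]] := nz _ _ Q0.
- by rewrite -capvA capvSl.
- move=> v; rewrite !memv_cap !memv_ker luE lwE e2 eqxx /= => /andP[/andP[_ /eqP h1] /eqP h2].
  by rewrite luE lwE (eDl _ _ _ eu h1) (eDl _ _ _ ew h2) eqxx.
move: vQ; rewrite !memv_cap !memv_ker luE lwE => /andP[/andP[_ /eqP h1] /eqP h2].
case: (eigvals e1 e2 e3 e4 amax t bN0 vN0 bv) => bE; subst b; case/eqP: vN0.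
  by rewrite (top_eigvec e1 e3 a0 amax t bv) lieC linearN /= h2 oppr0 scale0r.
rewrite (top_eigvec e1 e3 _ (max_eigvalN amax) (triple_sym t) bv) ?oppr_eq0 //.
by rewrite lieC lieNl opprK h1 scale0r.
Qed.

(** * Extension of scalars *)

(** The Lie algebra h extended to C, in the coordinates of h.  The embedding of
    fields is kept as a parameter because the bracket depends on it. *)
Definition scalar_ext (F : fieldType) (C : numClosedFieldType)
  (iota : {rmorphism F -> C}) (h : lieAlgType F) := 'rV[C]_(dim h).

Section ScalarExtension.
Variables (F : fieldType) (C : numClosedFieldType) (iota : {rmorphism F -> C}).
Variable h : lieAlgType F.

Local Notation hC := (scalar_ext iota h).

HB.instance Definition _ := Vector.on hC.

Implicit Types (x y : h) (X Y Z : hC).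

Definition ext_emb x : hC := map_mx iota (v2r x).

Definition std_vec (i : 'I_(dim h)) : h := r2v (delta_mx 0 i).

Definition ext_lie X Y : hC :=
  \sum_i \sum_j (X 0 i * Y 0 j) *: ext_emb (lie (std_vec i) (std_vec j)).

Lemma ext_embD x y : ext_emb (x + y) = ext_emb x + ext_emb y.
Proof. by rewrite /ext_emb linearD map_mxD. Qed.

Lemma ext_embN x : ext_emb (- x) = - ext_emb x.
Proof. by rewrite /ext_emb linearN map_mxN. Qed.

Lemma ext_embZ c x : ext_emb (c *: x) = iota c *: ext_emb x.
Proof. by rewrite /ext_emb linearZ map_mxZ. Qed.

Lemma ext_emb0 : ext_emb 0 = 0.
Proof. by rewrite /ext_emb linear0 map_mx0. Qed.

Lemma ext_emb_sum (I : finType) (f : I -> h) : ext_emb (\sum_i f i) = \sum_i ext_emb (f i).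
Proof. by elim/big_rec2: _ => [|i y1 y2 _ <-]; rewrite ?ext_emb0 ?ext_embD. Qed.

Lemma ext_emb_std i : ext_emb (std_vec i) = delta_mx 0 i.
Proof. by rewrite /ext_emb r2vK map_delta_mx. Qed.

Lemma ext_sumE X : X = \sum_i X 0 i *: ext_emb (std_vec i).
Proof. by rewrite {1}[X]row_sum_delta; apply: eq_bigr => i _; rewrite ext_emb_std. Qed.

Lemma vec_sumE x : x = \sum_i (v2r x) 0 i *: std_vec i.
Proof.
apply: v2r_inj; rewrite linear_sum /= {1}[v2r x]row_sum_delta.
by apply: eq_bigr => i _; rewrite linearZ /= r2vK.
Qed.

Lemma ext_lieC X Y : ext_lie X Y = - ext_lie Y X.
Proof.
rewrite /ext_lie exchange_big /= -sumrN; apply: eq_bigr => i _.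
rewrite -sumrN; apply: eq_bigr => j _.
by rewrite lieC ext_embN scalerN mulrC.
Qed.

Lemma ext_lie_linearl Y : linear (ext_lie^~ Y).
Proof.
move=> c X X'; rewrite /ext_lie scaler_sumr -big_split; apply: eq_bigr => i _ /=.
rewrite scaler_sumr -big_split; apply: eq_bigr => j _ /=.
by rewrite scalerA -scalerDl !mxE; congr (_ *: _); ring.
Qed.

Lemma ext_lie_linearr X : linear (ext_lie X).
Proof.
by move=> c Y Y'; rewrite ext_lieC ext_lie_linearl opprD -scalerN -!(ext_lieC X).
Qed.

Lemma ext_liexx X : ext_lie X X = 0.
Proof.
have /eqP := ext_lieC X X; rewrite -addr_eq0 -mulr2n -scaler_nat scaler_eq0.
by rewrite pnatr_eq0 => /eqP.
Qed.

Lemma ext_lie_emb x y : ext_lie (ext_emb x) (ext_emb y) = ext_emb (lie x y).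
Proof.
rewrite [in RHS](vec_sumE x) [in RHS](vec_sumE y).
rewrite lie_suml ext_emb_sum; apply: eq_bigr => i _.
rewrite lie_sumr ext_emb_sum; apply: eq_bigr => j _.
by rewrite lieZl lieZr !ext_embZ scalerA !mxE.
Qed.

(** The vectors coming from h span the extension. *)
Lemma ext_linear0 (f : hC -> hC) :
  (forall c, {morph f : X Y / c *: X + Y}) -> (forall x, f (ext_emb x) = 0) ->
  forall X, f X = 0.
Proof.
move=> flin f0 X; have f00 : f 0 = 0 by have := f0 0; rewrite ext_emb0.
rewrite (ext_sumE X); elim/big_rec: _ => [//|i Y _ fY].
by rewrite flin f0 fY scaler0 addr0.
Qed.

Definition ext_jacobian X Y Z :=
  ext_lie X (ext_lie Y Z) + ext_lie Y (ext_lie Z X) + ext_lie Z (ext_lie X Y).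

Lemma ext_jacobianC X Y Z : ext_jacobian X Y Z = ext_jacobian Y Z X.
Proof. by rewrite /ext_jacobian -addrA addrC. Qed.

Lemma ext_jacobian_linear c X X' Y Z :
  ext_jacobian (c *: X + X') Y Z = c *: ext_jacobian X Y Z + ext_jacobian X' Y Z.
Proof.
rewrite /ext_jacobian !(ext_lie_linearl, ext_lie_linearr).
by rewrite !scalerDr [in LHS](addrACA (c *: _)) [LHS]addrACA.
Qed.

(** The jacobiator is linear in each argument and cyclically symmetric, hence
    determined by its values on h. *)
Lemma ext_lie_jacobi X Y Z : ext_jacobian X Y Z = 0.
Proof.
move: X; apply: (ext_linear0 (f := fun X => ext_jacobian X Y Z)).
  by move=> c X X'; exact: ext_jacobian_linear.
move=> x; rewrite ext_jacobianC; move: Y.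
apply: (ext_linear0 (f := fun Y => ext_jacobian Y Z (ext_emb x))).
  by move=> c X X'; exact: ext_jacobian_linear.
move=> y; rewrite ext_jacobianC; move: Z.
apply: (ext_linear0 (f := fun Z => ext_jacobian Z (ext_emb x) (ext_emb y))).
  by move=> c X X'; exact: ext_jacobian_linear.
by move=> z; rewrite /ext_jacobian !ext_lie_emb -!ext_embD lie_jacobi ext_emb0.
Qed.

HB.instance Definition _ := Vector_isLieAlgebra.Build C hC
  ext_lie_linearl ext_lie_linearr ext_liexx ext_lie_jacobi.

(** Kernels of matrices commute with extension of scalars. *)
Lemma ext_ker n (M : 'M[F]_(dim h, n)) x :
  (forall y, v2r y *m M = 0 -> exists c, y = c *: x) ->
  forall Y : hC, Y *m map_mx iota M = 0 -> exists c, Y = c *: ext_emb x.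
Proof.
move=> kM Y YM; have /sub_rVP : (Y <= map_mx iota (v2r x))%MS.
  apply: submx_trans (_ : _ <= kermx (map_mx iota M))%MS _.
    exact/sub_kermxP.
  rewrite -map_kermx map_submx; apply/row_subP => i.
  have [|c cE] := kM (r2v (row i (kermx M))).
    by rewrite r2vK -row_mul mulmx_ker row0.
  by rewrite -[row i _]r2vK cE linearZ /= scalemx_sub.
by [].
Qed.

Definition ext_form (l : 'Hom(h, F^o)) (X : hC) : C^o :=
  \sum_i X 0 i * iota (l (std_vec i)).

Lemma ext_form_linear l : linear (ext_form l).
Proof.
move=> c X Y; rewrite /ext_form scaler_sumr -big_split; apply: eq_bigr => i _ /=.
by rewrite !mxE mulrDl -mulrA.
Qed.

HB.instance Definition _ l :=
  GRing.isLinear.Build C hC C^o *:%R (ext_form l) (ext_form_linear l).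

Lemma ext_form_emb l x : ext_form l (ext_emb x) = iota (l x).
Proof.
rewrite [in RHS](vec_sumE x) linear_sum rmorph_sum; apply: eq_bigr => i _.
by rewrite linearZ rmorphM mxE.
Qed.

End ScalarExtension.

Arguments ext_form {F C} iota {h} l X.
Arguments ext_emb {F C} iota {h} x.
Arguments std_vec {F h} i.

(** The last two hypotheses say that the kernel of a matrix with entries in F is
    the line of xi, so it survives the passage to C. *)
Lemma rank_one_dim_subfield (F : fieldType) (C : numClosedFieldType)
    (iota : {rmorphism F -> C}) (h : lieAlgType F) (eta : 'Hom(h, F^o)) (xi : h) :
  eta xi = 1 -> (forall y, eta (lie xi y) = 0) ->
  (forall x, lie xi x = 0 -> x = (eta x : F) *: xi) ->
  (forall x, (forall y, eta (lie x y) = 0) -> x = (eta x : F) *: xi) ->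
  (\dim {:h} <= 3)%N.
Proof.
move=> e1 e2 e3 e4.
pose L : lieAlgType C := scalar_ext iota h.
pose etaC : 'Hom(L, C^o) := linfun (ext_form iota eta : L -> C^o).
pose xiC : L := ext_emb iota xi.
have etaE x : etaC (ext_emb iota x : L) = iota (eta x) by rewrite lfunE; exact: ext_form_emb.
have etaxi : etaC xiC = 1 by rewrite etaE e1 rmorph1.
have eta_scale (X : L) c : X = c *: xiC -> X = etaC X *: xiC.
  by move=> ->; rewrite linearZ /= etaxi [_ *: 1]mulr1.
have etal Y : etaC (lie xiC Y) = 0.
  have -> : Y = \sum_i Y 0 i *: (ext_emb iota (std_vec i) : L) by exact: ext_sumE.
  rewrite lie_sumr linear_sum big1 // => i _.
  by rewrite lieZr linearZ /= [lie _ _]ext_lie_emb etaE e2 rmorph0 scaler0.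
have -> : \dim {:h} = \dim {:L}.
  by rewrite !dimvf [RHS](dim_matrix C 1 (dim h)); exact/esym/mul1n.
apply: (@rank_one_dim C L etaC xiC) => // X.
- pose M := lin1_mx (v2r \o lie xi \o r2v).
  have MX : X *m map_mx iota M = lie xiC X.
    have -> : X = \sum_i X 0 i *: (ext_emb iota (std_vec i) : L) by exact: ext_sumE.
    rewrite lie_sumr mulmx_suml; apply: eq_bigr => i _.
    rewrite lieZr -scalemxAl; congr (_ *: _); rewrite [RHS]ext_lie_emb.
    by rewrite -map_mxM mul_rV_lin1 /= v2rK.
  have kM y : v2r y *m M = 0 -> exists c, y = c *: xi.
    rewrite mul_rV_lin1 /= v2rK => y0; exists (eta y); apply: e3.
    by apply: v2r_inj; rewrite y0 linear0.
  by move=> X0; have [|c /eta_scale//] := ext_ker kM (Y := X); rewrite MX.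
pose M := \matrix_(i, j) eta (lie (std_vec i : h) (std_vec j)).
have MX (Y : 'rV[C]_(dim h)) j : (Y *m map_mx iota M) 0 j = etaC (lie (Y : L) (ext_emb iota (std_vec j))).
  rewrite {2}(ext_sumE (Y : scalar_ext iota h)) lie_suml linear_sum mxE; apply: eq_bigr => i _.
  by rewrite lieZl linearZ /= [lie _ _]ext_lie_emb etaE !mxE.
have kM y : v2r y *m M = 0 -> exists c, y = c *: xi.
  move=> y0; exists (eta y); apply: e4 => z.
  rewrite (vec_sumE z) lie_sumr linear_sum big1 // => j _; rewrite lieZr linearZ /=.
  suff -> : eta (lie y (std_vec j)) = 0 by rewrite scaler0.
  have := congr1 (fun A : 'rV_ _ => A 0 j) y0; rewrite !mxE => <-.
  rewrite {1}(vec_sumE y) lie_suml linear_sum; apply: eq_bigr => i _.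
  by rewrite lieZl linearZ !mxE.
move=> X0; have [|c /eta_scale//] := ext_ker kM (Y := X).
by apply/rowP => j; rewrite MX X0 mxE.
Qed.

(** * Skew forms invariant under an invertible operator *)

(** For row vectors u and v, the bilinear form u b v^T is skew and satisfies
    (uD) b v^T + u b (vD)^T = 0. *)
Definition skew_invariant (R : pzRingType) n (D b : 'M[R]_n) :=
  b^T = - b /\ D *m b = - (b *m D^T).

Section SkewInvariant.
Variable (C : numClosedFieldType).

Definition col_eigenspace n (D : 'M[C]_n) (a : C) : {vspace 'rV[C]_n} :=
  lker (linfun (mulmxr (D^T - a%:M : 'M[C]_n) : 'rV[C]_n -> 'rV[C]_n)).

Lemma col_eigenspaceP n (D : 'M[C]_n) a y :
  (y \in col_eigenspace D a) = (y *m D^T == a *: y).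
Proof.
rewrite memv_ker lfunE /= mulmxBr subr_eq0.
by rewrite mul_mx_scalar.
Qed.

(** The eigenspaces of a and -a are independent because a <> 0, so one of
    them has dimension at most n/2; exchanging a and -a if needed, it is that
    of -a. *)
Lemma small_opposite_eigenspace n (D : 'M[C]_n) : (0 < n)%N -> D \in unitmx ->
  exists a (v : 'rV_n), [/\ v != 0, v *m D = a *: v, a != 0 &
    (\dim (col_eigenspace D (- a)) <= n./2)%N].
Proof.
move=> n0 uD; have [a aD] := eigenvalue_closed D n0.
have nz b (v : 'rV_n) : v != 0 -> v *m D = b *: v -> b != 0.
  move=> v0 vD; apply: contraNneq v0 => b0.
  by rewrite -[v](mulmxK uD) vD b0 scale0r mul0mx.
have evT b : eigenvalue D^T b -> eigenvalue D b.
  rewrite !eigenvalue_root_char; suff -> : char_poly D^T = char_poly D by [].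
  by rewrite /char_poly -det_tr /char_poly_mx linearB /= tr_scalar_mx map_trmx trmxK.
have /eigenvalueP [v vD v0] := aD.
have [h|h] := leqP (\dim (col_eigenspace D (- a))) n./2.
  by exists a, v; split => //; exact: nz vD.
have a0 := nz _ _ v0 vD.
have /evT/eigenvalueP [w wD w0] : eigenvalue D^T (- a).
  have : col_eigenspace D (- a) != 0%VS by rewrite -dimv_eq0; case: (\dim _) h.
  rewrite -vpick0 => p0; apply/eigenvalueP; exists (vpick (col_eigenspace D (- a))) => //.
  by apply/eqP; rewrite -col_eigenspaceP memv_pick.
exists (- a), w; split => //; first by rewrite oppr_eq0.
rewrite opprK.
have disj : (col_eigenspace D a :&: col_eigenspace D (- a) = 0)%VS.
  apply/eqP; rewrite -subv0; apply/subvP => y; rewrite memv_cap !col_eigenspaceP memv0.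
  case/andP => /eqP -> ; rewrite -subr_eq0 -scalerBl opprK scaler_eq0 -mulr2n.
  by rewrite mulrn_eq0 (negPf a0).
have := dimvS (subvf (col_eigenspace D a + col_eigenspace D (- a))%VS).
rewrite dimv_disjoint_sum // dimvf [dim _](dim_matrix C 1 n) => le_n.
have {}le_n : (\dim (col_eigenspace D a) + \dim (col_eigenspace D (- a)) <= n)%N.
  by rewrite -[X in (_ <= X)%N]mul1n; exact: le_n.
have := odd_double_half n; move: h le_n.
generalize (\dim (col_eigenspace D (- a))) (\dim (col_eigenspace D a)).
by case: (odd n) => k l; lia.
Qed.

(** Let v be an eigenvector of D for a.  For an invariant skew form b, the
    functional v b is a left eigenvector of D for -a, which leaves at most n/2
    dimensions; and the forms with v b = 0 live on the quotient by v, where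
    induction applies.  The bound is floor(n/2) * ceil(n/2). *)
Lemma skew_invariant_dim n (D : 'M[C]_n) (U : {vspace 'M[C]_n}) : D \in unitmx ->
  (forall b, b \in U -> skew_invariant D b) -> (\dim U <= n./2 * uphalf n)%N.
Proof.
elim: n D U => [|n IH]; last rewrite -[n.+1]/(1 + n)%N; move=> D U uD UP.
  apply: leq_trans (dimvS (subvf U)) _.
  by rewrite dimvf [dim _](dim_matrix C 0 0).
have [a [v0 [v00 v0D a0 small]]] := @small_opposite_eigenspace (1 + n) D (ltn0Sn n) uD.
(* P is a change of basis whose first row is an eigenvector. *)
have [P [uP [v [v0' vD vE]]]] : exists P : 'M[C]_(1 + n), P \in unitmx /\
    exists v : 'rV_(1 + n), [/\ v != 0, v *m D = a *: v & usubmx P = v].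
  exists (row_ebase v0); split; first exact: row_ebase_unit.
  exists (usubmx (row_ebase v0)).
  have rk : \rank v0 = 1%N by rewrite rank_rV v00.
  have v0E : v0 = (col_ebase v0) 0 0 *: usubmx (row_ebase v0).
    rewrite -[LHS]mulmx_ebase rk (@pid_mx_row _ n 1) -{1}[row_ebase v0]vsubmxK.
    rewrite -mulmxA mul_row_col mul1mx mul0mx addr0.
    by rewrite [col_ebase v0 in LHS]mx11_scalar mul_scalar_mx.
  have c0 : (col_ebase v0) 0 0 != 0.
    by apply: contra_neq v00 => c0; rewrite v0E c0 scale0r.
  split => //; first by apply: contra_neq v00 => e; rewrite v0E e scaler0.
  apply: (scalerI c0); rewrite scalemxAl scalerA mulrC -scalerA -!v0E.
  exact: v0D.
pose D' : 'M_(1 + n) := P *m D *m invmx P; pose D1 := drsubmx D'.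
have uP' : P^T \in unitmx by rewrite unitmx_tr.
(* In the new basis D is block triangular; D1 is its action on the quotient. *)
have D'E : D' = block_mx a%:M 0 (dlsubmx D') D1.
  have uD' : usubmx D' = a *: usubmx (1%:M : 'M_(1 + n)).
    by rewrite /D' -!mul_usub_mx vE vD -scalemxAl -vE mul_usub_mx mulmxV.
  rewrite -[LHS]submxK; congr block_mx.
    by rewrite /ulsubmx uD' linearZ /= -/(ulsubmx _) scalar_mx_block block_mxKul scalemx1.
  by rewrite /ursubmx uD' linearZ /= -/(ursubmx _) scalar_mx_block block_mxKur scaler0.
have uD1 : D1 \in unitmx.
  have : D' \in unitmx by rewrite !unitmx_mul uP uD unitmx_inv uP.
  by rewrite D'E unitmxE det_lblock unitrM -unitmxE => /andP[].
pose rho := linfun (mulmx v : 'M[C]_(1 + n) -> 'rV_(1 + n)).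
pose sg (b : 'M[C]_(1 + n)) : 'M[C]_n := drsubmx (P *m b *m P^T).
have sg_lin : linear sg.
  move=> c x y; rewrite /sg mulmxDr -scalemxAr mulmxDl -scalemxAl.
  by apply/matrixP => i j; move: (P *m x *m P^T) (P *m y *m P^T) => x' y'; rewrite !mxE.
pose sgL := GRing.isLinear.Build C 'M[C]_(1 + n) 'M[C]_n *:%R sg sg_lin.
pose sigma : {linear 'M[C]_(1 + n) -> 'M[C]_n} := HB.pack sg sgL.
pose s := linfun sigma.
have sE b : s b = drsubmx (P *m b *m P^T) by rewrite lfunE.
pose W := (U :&: lker rho)%VS.
have WP b : b \in W -> skew_invariant D b /\ P *m b *m P^T = block_mx 0 0 0 (s b).
  rewrite memv_cap memv_ker lfunE /= => /andP[/UP sb /eqP vb]; split => //.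
  have u0 : usubmx (P *m b *m P^T) = 0 by rewrite -!mul_usub_mx vE vb mul0mx.
  rewrite sE -[LHS]submxK {1}/ulsubmx {1}/ursubmx u0 !linear0; congr block_mx.
  have -> : dlsubmx (P *m b *m P^T) = - (ursubmx (P *m b *m P^T))^T.
    rewrite trmx_ursub !trmx_mul trmxK sb.1 mulNmx mulmxN mulmxA.
    by move: (P *m b *m P^T) => M; apply/matrixP => i j; rewrite !mxE opprK.
  by rewrite /ursubmx u0 linear0 trmx0 oppr0.
have dimW : (\dim W <= n./2 * uphalf n)%N.
  rewrite -(@limg_dim_eq _ _ _ s W); last first.
    apply/eqP; rewrite -subv0; apply/subvP => b; rewrite memv_cap memv_ker memv0.
    move=> /andP[/WP[_ bE] /eqP sb]; move: bE; rewrite sb.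
    rewrite -[RHS]/(block_mx 0 0 0 0) block_mx0 => /(canRL (mulmxK uP')).
    by rewrite mul0mx => /(canRL (mulKmx uP)); rewrite mulmx0 => ->.
  apply: (IH D1) => // c /memv_imgP[b /WP[[bT bD] bE] ->].
  have ET : (P *m b *m P^T)^T = - (P *m b *m P^T).
    by rewrite !trmx_mul trmxK bT mulNmx mulmxN mulmxA.
  have ED : D' *m (P *m b *m P^T) = - (P *m b *m P^T *m D'^T).
    rewrite /D' !trmx_mul !mulmxA mulmxKV //.
    rewrite -[P *m b *m P^T *m _]mulmxA trmx_inv mulmxV // mulmx1.
    by rewrite -[P *m D *m b]mulmxA bD mulmxN mulNmx !mulmxA.
  split.
    move: ET; rewrite bE tr_block_mx !trmx0 opp_block_mx !oppr0.
    by case/eq_block_mx.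
  move: ED; rewrite bE {1}D'E mulmx_block D'E tr_block_mx mulmx_block.
  rewrite !(mul0mx, mulmx0, add0r, addr0) opp_block_mx.
  by case/eq_block_mx.
rewrite -(limg_ker_dim rho U).
have img : (\dim (rho @: U) <= n.+1./2)%N.
  apply: leq_trans small; apply: dimvS; apply/subvP => y /memv_imgP[b /UP[bT bD] ->].
  rewrite col_eigenspaceP lfunE /= -mulmxA -[b *m _]opprK -bD mulmxN mulmxA vD.
  by rewrite -scalemxAl scaleNr.
apply: leq_trans (leq_add dimW img) _.
rewrite add1n /= uphalf_half; move: (odd n) n./2 => o h.
by case: o; nia.
Qed.

End SkewInvariant.

Lemma skew_invariant_sum (R : comPzRingType) n (D : 'M[R]_n) m (c : 'I_m -> R)
    (b : 'I_m -> 'M[R]_n) :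
  (forall i, skew_invariant D (b i)) -> skew_invariant D (\sum_i c i *: b i).
Proof.
move=> sb; split.
  rewrite linear_sum -sumrN; apply: eq_bigr => i _.
  by rewrite linearZ /= (sb i).1 scalerN.
rewrite mulmx_sumr mulmx_suml -sumrN; apply: eq_bigr => i _.
by rewrite -scalemxAr (sb i).2 -scalemxAl scalerN.
Qed.

(** Linear independence of matrices is a rank condition, so it persists over C. *)
Lemma skew_invariant_dim_subfield (F : fieldType) (C : numClosedFieldType)
    (iota : {rmorphism F -> C}) n (D : 'M[F]_n) (U : {vspace 'M[F]_n}) :
  D \in unitmx -> (forall b, b \in U -> skew_invariant D b) ->
  (\dim U <= n./2 * uphalf n)%N.
Proof.
move=> uD UP.
have UB (i : 'I_(\dim U)) : skew_invariant D (vbasis U)`_i.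
  by apply/UP/vbasis_mem/mem_nth; rewrite size_tuple.
pose B : 'M[F]_(\dim U, n * n) := \matrix_i mxvec (vbasis U)`_i.
have frB : row_free (map_mx iota B).
  rewrite row_free_map; apply: inj_row_free => c c0.
  have /freeP fb := basis_free (vbasisP U).
  apply/rowP => i; rewrite mxE; apply: (fb (fun i => c 0 i)).
  apply: (can_inj mxvecK); rewrite linear0 -c0 linear_sum mulmx_sum_row.
  by apply: eq_bigr => j _; rewrite linearZ /= rowK.
pose X : (\dim U).-tuple 'M[C]_n := [tuple map_mx iota (vbasis U)`_i | i < \dim U].
have XE (i : 'I_(\dim U)) : X`_i = map_mx iota (vbasis U)`_i.
  by rewrite -tnth_nth tnth_mktuple.
have frX : free X.
  apply/freeP => c c0 i.
  have c1 : (\row_i c i) *m map_mx iota B = 0.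
    rewrite mulmx_sum_row; rewrite -[RHS](linear0 mxvec) -c0 linear_sum.
    apply: eq_bigr => j _; rewrite linearZ /= mxE XE; congr (_ *: _).
    by rewrite -map_row rowK map_mxvec.
  have := row_free_inj frB; move/(_ _ (\row_i c i) 0); rewrite c1 mul0mx.
  by move=> /(_ erefl)/rowP/(_ i); rewrite !mxE.
rewrite -(size_tuple X) -(eqP frX).
apply: (@skew_invariant_dim _ _ (map_mx iota D)); first by rewrite map_unitmx.
have map_trmx_iota (A : 'M[F]_n) : map_mx iota A^T = (map_mx iota A)^T.
  by apply/matrixP => i j; rewrite !mxE.
move=> b /coord_span ->; apply: skew_invariant_sum => i; rewrite XE.
have [bT bD] := UB i; split; first by rewrite -map_trmx_iota bT map_mxN.
by rewrite -map_mxM bD map_mxN map_mxM map_trmx_iota.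
Qed.

(** * Wedge products and the kernel of a contact form *)

Section KForms.
Variables (R : numFieldType) (V : vectType R).
Implicit Types (x y : V).

Definition kreplace k (v : 'I_k -> V) (i : 'I_k) x : 'I_k -> V :=
  fun j => if j == i then x else v j.

Definition kmultilinear k (a : kform V k) := forall v i c x y,
  a (kreplace v i (c *: x + y)) = c * a (kreplace v i x) + a (kreplace v i y).

Definition kkills x k (a : kform V k) := forall v i, v i = x -> a v = 0.

Definition kalternating k (a : kform V k) :=
  forall v (i j : 'I_k), i != j -> v i = v j -> a v = 0.

Lemma kreplaceE k (v : 'I_k -> V) i : kreplace v i (v i) = v.
Proof. by apply/funext => j; rewrite /kreplace; case: eqP => [->|]. Qed.

Lemma wedge_multilinear p q (a : kform V p) (b : kform V q) :
  kmultilinear a -> kmultilinear b -> kmultilinear (wedge a b).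
Proof.
move=> la lb v i c x y; rewrite /wedge mulrCA -mulrDr; congr (_ * _).
rewrite mulr_sumr -big_split /=; apply: eq_bigr => s _.
rewrite [c * _]mulrCA -mulrDr; congr (_ * _).
pose L z := fun j => kreplace v i z (s (lshift q j)).
pose Q z := fun j => kreplace v i z (s (rshift p j)).
rewrite -/(L x) -/(L y) -/(L (c *: x + y)) -/(Q x) -/(Q y) -/(Q (c *: x + y)).
have [k sk] : exists k, s k = i by exists (s^-1%g i); rewrite permKV.
case: (split_ordP k) sk => k' -> sk.
- have EL z : L z = kreplace (fun j => v (s (lshift q j))) k' z.
    apply/funext => j; rewrite /L /kreplace -sk (inj_eq perm_inj).
    by rewrite (inj_eq (@lshift_inj _ _)).
  have EQ z : Q z = fun j => v (s (rshift p j)).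
    by apply/funext => j; rewrite /Q /kreplace -sk (inj_eq perm_inj) eq_rlshift.
  by rewrite !EL !EQ la; ring.
have EL z : L z = fun j => v (s (lshift q j)).
  by apply/funext => j; rewrite /L /kreplace -sk (inj_eq perm_inj) eq_lrshift.
have EQ z : Q z = kreplace (fun j => v (s (rshift p j))) k' z.
  apply/funext => j; rewrite /Q /kreplace -sk (inj_eq perm_inj).
  by rewrite (inj_eq (@rshift_inj _ _)).
by rewrite !EL !EQ lb; ring.
Qed.

Lemma wedge_kills x p q (a : kform V p) (b : kform V q) :
  kkills x a -> kkills x b -> kkills x (wedge a b).
Proof.
move=> xa xb v i vi; rewrite /wedge big1 ?mulr0 // => s _.
have [k sk] : exists k, s k = i by exists (s^-1%g i); rewrite permKV.
case: (split_ordP k) sk => k' -> sk; first by rewrite (xa _ k') ?sk // mul0r mulr0.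
by rewrite (xb _ k') ?sk // !mulr0.
Qed.

(** Exchanging two equal arguments permutes the terms of the sum and changes
    their signs. *)
Lemma wedge_alternating p q (a : kform V p) (b : kform V q) :
  kalternating (wedge a b).
Proof.
move=> v i j ij vij; rewrite /wedge.
set S := \sum_s _; suff: S = - S.
  by move/eqP; rewrite -addr_eq0 -mulr2n mulrn_eq0 => /eqP ->; rewrite mulr0.
rewrite {1}/S (reindex_inj (mulIg (tperm i j))) /= -sumrN; apply: eq_bigr => s _.
rewrite odd_permM odd_tperm ij signr_addb /= mulrN1 mulNr.
have E k : v ((s * tperm i j)%g k) = v (s k).
  by rewrite permM; case: tpermP => [->|->|].
congr (- (_ * (a _ * b _))); apply/funext => k; exact: E.
Qed.

Lemma kmultilinear0 k (a : kform V k) v i : kmultilinear a -> a (kreplace v i 0) = 0.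
Proof.
move=> la; have := la v i 1 0 0; rewrite scaler0 addr0 mul1r => /eqP.
by rewrite -subr_eq0 opprD addrA subrr add0r oppr_eq0 => /eqP.
Qed.

Lemma kmultilinear_sum k (a : kform V k) v i m (c : 'I_m -> R) (z : 'I_m -> V) :
  kmultilinear a -> a (kreplace v i (\sum_j c j *: z j)) = \sum_j c j * a (kreplace v i (z j)).
Proof.
move=> la; elim/big_rec2: _ => [|j s t _ <-]; first exact: kmultilinear0.
exact: la.
Qed.

(** The \dim V vectors v i are dependent modulo x: some combination of them
    with a nonzero coefficient c i is a multiple of x.  Replacing v i by this
    combination multiplies the value of the form by c i, but also annihilates it. *)
Lemma top_form_kernel x (a : kform V (\dim {:V})) :
  kmultilinear a -> kalternating a -> kkills x a -> x != 0 -> forall v, a v = 0.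
Proof.
move=> la alternation kx x0 v.
pose X := [tuple v i | i < \dim {:V}].
have XE (i : 'I_(\dim {:V})) : X`_i = v i by rewrite -tnth_nth tnth_mktuple.
suff [c [i ci [t E]]] : exists c : 'I_(\dim {:V}) -> R, exists2 i, c i != 0 &
    exists t, \sum_j c j *: v j = t *: x.
  have := kmultilinear_sum v i c v la; rewrite E (bigD1 i) //= big1 => [|j ji].
    rewrite -[t *: x]addr0 la (kmultilinear0 _ _ la) (kx _ i); last first.
      by rewrite /kreplace eqxx.
    by rewrite kreplaceE mulr0 !addr0 => /esym/eqP; rewrite mulf_eq0 (negPf ci) => /eqP.
  by rewrite (alternation _ i j) ?mulr0 // 1?eq_sym // /kreplace eqxx (negPf ji).
have [frX|nfrX] := boolP (free X).
  have bX : basis_of {:V} X by rewrite basisEfree frX subvf size_tuple /=.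
  pose c i := coord X i x; have xE : x = \sum_j c j *: v j.
    rewrite {1}(coord_basis bX (memvf x)); apply: eq_bigr => j _.
    by rewrite XE.
  have [i ci] : exists i, c i != 0.
    apply: contrapT => nc; case/eqP: x0; rewrite xE big1 // => j _.
    by apply/eqP; apply: contrapT => cj; apply: nc; exists j;
      apply: contra_notN cj => /eqP ->; rewrite scale0r.
  by exists c; exists i => //; exists 1; rewrite -xE scale1r.
have [c [c0 [i ci]]] : exists c : 'I_(\dim {:V}) -> R,
    \sum_j c j *: X`_j = 0 /\ exists i, c i != 0.
  apply: contrapT => nc; case/negP: nfrX; apply/freeP => c c0 i.
  by apply/eqP; apply: contrapT => ci; apply: nc; exists c; split => //; exists i; apply/negP.
exists c; exists i => //; exists 0; rewrite scale0r -[RHS]c0.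
by apply: eq_bigr => j _; rewrite XE.
Qed.

End KForms.

Section ContactNondegenerate.
Variables (R : numFieldType) (g : lieAlgType R) (eta : 'Hom(g, R^o)).

Lemma contact_nondegenerate : contact eta ->
  forall x, eta x = 0 -> (forall y, eta (lie x y) = 0) -> x = 0.
Proof.
move=> [n [dg [v vN0]]] x ex exy; apply/eqP; apply: contrapT => /negP x0.
have lin2 : kmultilinear (kform2 (dform1 eta)).
  move=> u i c y z; rewrite /kform2 /dform1 /kreplace.
  have : (i == ord0) || (i == ord_max) by case: i => [[|[|]]].
  case/orP => /eqP -> /=.
    by rewrite lieDl lieZl linearD linearZ /= opprD mulrN.
  by rewrite lieDr lieZr linearD linearZ /= opprD mulrN.
have kil2 : kkills x (kform2 (dform1 eta)).
  move=> u i; rewrite /kform2 /dform1.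
  have : (i == ord0) || (i == ord_max) by case: i => [[|[|]]].
  case/orP => /eqP -> -> /=; first by rewrite exy oppr0.
  by rewrite lieC linearN /= exy !oppr0.
have linp : kmultilinear (wedge_pow (kform2 (dform1 eta)) n).
  by elim: (n) => [v' []//|k IH]; exact: wedge_multilinear.
have kilp : kkills x (wedge_pow (kform2 (dform1 eta)) n).
  by elim: (n) => [v' []//|k IH]; exact: wedge_kills.
have lin1 : kmultilinear (kform1 eta).
  by move=> u i c y z; rewrite /kform1 /kreplace (ord1 i) /= linearD linearZ.
have kil1 : kkills x (kform1 eta) by move=> u i; rewrite /kform1 (ord1 i) => ->.
have E : (1 + n * 2)%N = \dim {:g} by rewrite dg addnC mulnC.
case/eqP: vN0; move: v (wedge_multilinear lin1 linp) (wedge_kills kil1 kilp)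
  (@wedge_alternating _ _ _ _ (kform1 eta) (wedge_pow (kform2 (dform1 eta)) n)).
move: (wedge _ _); rewrite E => a v la ka aa.
exact: top_form_kernel la aa ka x0 v.
Qed.

End ContactNondegenerate.

(** * Top exterior powers of a nondegenerate 2-form *)

Section WedgePow.
Variables (R : numFieldType) (V : vectType R).

Definition alternation k (a : kform V k) : kform V k :=
  fun v => \sum_(s : 'S_k) (-1) ^+ s * a (v \o s).

Definition tensor p q (a : kform V p) (b : kform V q) : kform V (p + q) :=
  fun v => a (v \o @lshift p q) * b (v \o @rshift p q).

(** A permutation of the last q indices, extended by the identity, keeps its
    sign, as one sees on a product of transpositions. *)
Lemma rshift_perm p q (r : 'S_q) : exists r' : 'S_(p + q),
  [/\ r' = r :> bool, forall i, r' (lshift q i) = lshift q i &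
      forall i, r' (rshift p i) = rshift p (r i)].
Proof.
have [ts -> dts] := prod_tpermP r.
elim: ts dts => [|t ts IH] /= => [_|/andP[dt /IH[r' [or' lr' rr']]]].
  by exists 1%g; rewrite big_nil !odd_perm1; split => // i; rewrite !perm1.
exists (tperm (rshift p t.1) (rshift p t.2) * r')%g.
rewrite big_cons; split => [|i|i].
- by rewrite !odd_permM !odd_tperm (inj_eq (@rshift_inj _ _)) or'.
- by rewrite permM tpermD ?lr' // eq_rlshift.
by rewrite !permM -(inj_tperm _ _ _ (@rshift_inj p q)) rr'.
Qed.

(** Alternating one factor before alternating the whole product only repeats
    each term q! times. *)
Lemma wedge_alternation p q (a : kform V p) (b : kform V q) c v :
  wedge a (fun u => c * alternation b u) v =
  ((p`! * q`!)%:R^-1 * c * (q`!)%:R) * alternation (tensor a b) v.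
Proof.
rewrite /wedge -!mulrA; congr (_ * _).
transitivity (c * \sum_(r : 'S_q) alternation (tensor a b) v); last first.
  by rewrite sumr_const card_Sn mulr_natl.
rewrite mulr_sumr /alternation.
under eq_bigr => s _ do rewrite mulrCA mulr_sumr mulrCA !mulr_sumr.
rewrite exchange_big /=; apply: eq_bigr => r _; rewrite mulr_sumr.
have [r' [or' lr' rr']] := rshift_perm p r.
rewrite [RHS](reindex_inj (mulgI r')) /=; apply: eq_bigr => s _.
rewrite odd_permM or' signr_addb /tensor.
have -> : a ((v \o (r' * s)%g) \o @lshift p q) = a (fun i => v (s (lshift q i))).
  by congr a; apply/funext => i; rewrite /= permM lr'.
have -> : b ((v \o (r' * s)%g) \o @rshift p q) =
          b ((fun j => v (s (rshift p j))) \o r).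
  by congr b; apply/funext => i; rewrite /= permM rr'.
move: (a _) (b _) ((-1) ^+ s) ((-1) ^+ r) => A B S T.
by ring.
Qed.

Fixpoint tensor_pow (b : kform V 2) n : kform V (n * 2) :=
  match n with
  | 0 => fun _ => 1
  | n'.+1 => tensor b (@tensor_pow b n')
  end.
Arguments tensor_pow b n v : clear implicits.

(** Up to a positive factor the n-th exterior power is the alternation of the
    n-th tensor power. *)
Lemma wedge_pow_alternation (b : kform V 2) n :
  exists2 c, 0 < c & wedge_pow b n = fun v => c * alternation (tensor_pow b n) v.
Proof.
elim: n => [|n [c c0 IH]].
  exists 1 => //; apply/funext => v /=; rewrite mul1r /alternation (eq_bigr (fun=> 1)).
    by rewrite sumr_const card_Sn.
  move=> s _; rewrite mulr1; suff -> : s = 1%g by rewrite odd_perm1.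
  by apply/permP => -[].
exists (((2)`! * (n * 2)`!)%:R^-1 * c * ((n * 2)`!)%:R).
  by rewrite !mulr_gt0 // ?invr_gt0 ltr0n ?muln_gt0 ?fact_gt0.
by apply/funext => v; rewrite /= IH wedge_alternation.
Qed.

(** The form w is the alternation of b, and exterior products only see
    alternations.  A non-skew b is convenient since on a Darboux basis it can
    be chosen with values 0 and 1, which removes all sign questions but one. *)
Lemma wedge_pow_skew (w b : V -> V -> R) n :
  (forall x y, w x y = b x y - b y x) ->
  wedge_pow (kform2 w) n = fun v => 2 ^+ n * wedge_pow (kform2 b) n v.
Proof.
move=> wb; elim: n => [|n IH]; first by apply/funext => v; rewrite mul1r.
apply/funext => v; rewrite /= IH.
rewrite /wedge mulrCA; congr (_ * _).
pose X (s : 'S_(2 + n * 2)) (i j : 'I_2) :=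
  (-1) ^+ s * (b (v (s (lshift _ i))) (v (s (lshift _ j))) *
  wedge_pow (kform2 b) n (fun j => v (s (rshift 2 j)))).
have swap : \sum_s X s ord0 ord_max = - \sum_s X s ord_max ord0.
  pose t := tperm (lshift (n * 2) (ord0 : 'I_2)) (lshift (n * 2) ord_max).
  rewrite (reindex_inj (mulgI t)) /= -sumrN; apply: eq_bigr => s _; rewrite /X.
  have -> : odd_perm (t * s) = ~~ s.
    by rewrite odd_permM odd_tperm (inj_eq (@lshift_inj _ _)).
  rewrite signrN.
  rewrite !permM tpermL tpermR mulNr; congr (- (_ * (_ * _))).
  by congr wedge_pow; apply/funext => j; rewrite permM tpermD // eq_lrshift.
transitivity (2 ^+ n * (\sum_s X s ord0 ord_max - \sum_s X s ord_max ord0)).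
  rewrite -sumrB mulr_sumr; apply: eq_bigr => s _.
  rewrite /X [kform2 w _]/kform2 wb.
  move: (wedge_pow _ _ _) ((-1) ^+ s) (2 ^+ n) => W S T.
  move: (v (s _)) (v (s _)) => x y; move: (b _ _) (b _ _) => p q; ring.
by rewrite -swap -mulr2n exprSr -mulrA mulr_natl.
Qed.

End WedgePow.

Arguments tensor_pow {R V} b n v.

(** A permutation that fixes 0 and maps each pair (2i+1, 2i+2) to such a pair
    moves the odd indices and the even ones in the same way: it is the product of
    its action on the odd indices and of a conjugate of that action, so its sign
    is a square. *)
Lemma pair_perm_even n (s : 'S_(n * 2).+1) :
  s ord0 = ord0 ->
  (forall i j : 'I_(n * 2).+1, odd i -> j = i.+1 :> nat ->
     odd (s i) /\ s j = (s i).+1 :> nat) ->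
  s = false :> bool.
Proof.
move=> s0 sP.
(* The involution that exchanges the two elements of each pair. *)
pose mate (i : nat) := if i == 0%N then 0%N else if odd i then i.+1 else i.-1.
have mateP i : (i < (n * 2).+1)%N -> (mate i < (n * 2).+1)%N.
  by rewrite /mate; have := oddM n 2; do 2 case: ifP => //=; lia.
have mateK i : mate (mate i) = i.
  case: i => [//|[//|i]]; have [oi|oi] := boolP (odd i).
    by rewrite /mate /= !oi /= oi.
  by rewrite /mate /= (negPf oi) /= oi.
pose mt (i : 'I_(n * 2).+1) : 'I_(n * 2).+1 := inord (mate i).
have mtE i : mt i = mate i :> nat by rewrite inordK ?mateP.
have mtK : involutive mt by move=> i; apply: ord_inj; rewrite !mtE mateK.
pose t := perm (can_inj mtK).
have next (i : 'I_(n * 2).+1) : odd i -> exists j : 'I_(n * 2).+1, j = i.+1 :> nat.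
  move=> oi; have ib := ltn_ord i.
  have ib' : (i.+1 < (n * 2).+1)%N by have := oddM n 2; lia.
  by exists (Ordinal ib').
have so (i : 'I_(n * 2).+1) : odd i -> odd (s i).
  by move=> oi; have [j ji] := next i oi; case: (sP i j).
pose so_fun (i : 'I_(n * 2).+1) := if odd i then s i else i.
have so_inj : injective so_fun.
  move=> i j; rewrite /so_fun; case: ifP => oi; case: ifP => oj //; first exact: perm_inj.
    by move=> e; move: (so i oi); rewrite e oj.
  by move=> e; move: (so j oj); rewrite -e oi.
pose e := perm so_inj.
(* The first factor acts on the odd indices, its conjugate on the even ones. *)
have -> : s = (e * e ^ t)%g.
  apply/permP => i; rewrite permM.
  have conj (j : 'I_(n * 2).+1) : (e ^ t)%g j = mt (so_fun (mt j)).
    by rewrite -{1}[j]mtK -[X in (e ^ t)%g X](permE (can_inj mtK)) permJ !permE.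
  rewrite conj permE; apply: ord_inj; rewrite mtE.
  have [oi|oi] := boolP (odd i).
    rewrite {2}/so_fun oi /so_fun mtE.
    have oN : odd (mate (s i)) = false.
      by rewrite /mate; have := so i oi; case: eqP => [->//|_] h; rewrite h /= h.
    by rewrite oN mtE mateK.
  rewrite {2}/so_fun (negPf oi) /so_fun mtE.
  case: (posnP i) => [i0|i0].
    have -> : i = ord0 by apply: val_inj.
    by rewrite s0 [odd _]/= mtE mateK.
  have oi1 : odd (mate i) by rewrite /mate; case: eqP => [|_]; [lia | rewrite (negPf oi); lia].
  rewrite oi1.
  have mi : i = (mt i).+1 :> nat.
    by rewrite mtE /mate; case: eqP => [|_]; [lia | rewrite (negPf oi); lia].
  have [|os ->] := sP (mt i) i _ mi; first by rewrite mtE.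
  by rewrite /mate os; case: eqP => // h; rewrite h in os.
by rewrite odd_permM odd_permJ addbb.
Qed.

Section Evaluation.
Variables (R : numFieldType) (V : vectType R) (b : V -> V -> R).

(** Here t k is the position of the k-th vector in a list of vectors on which
    b is 1 for the pairs (2i+1, 2i+2) and 0 otherwise.  The value of the tensor
    power is then 0 or 1, and it is 1 exactly when every factor meets such a
    pair. *)
Lemma tensor_pow_pairs n (u : 'I_(n * 2) -> V) (t : 'I_(n * 2) -> nat) :
  (forall k l, b (u k) (u l) = (odd (t k) && (t l == (t k).+1))%:R) ->
  exists2 c : bool, tensor_pow (kform2 b) n u = c%:R &
    c <-> (forall k l : 'I_(n * 2), ~~ odd k -> l = k.+1 :> nat ->
            odd (t k) /\ t l = (t k).+1).
Proof.
elim: n u t => [|n IH] u t ub; first by exists true => //; split => // _ [].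
have [|c cE cP] := IH (u \o @rshift 2 (n * 2)) (t \o @rshift 2 (n * 2)).
  by move=> k l; exact: ub.
pose k0 : 'I_(n.+1 * 2) := lshift (n * 2) (ord0 : 'I_2).
pose k1 : 'I_(n.+1 * 2) := lshift (n * 2) (ord_max : 'I_2).
exists ((odd (t k0) && (t k1 == (t k0).+1)) && c).
  have -> : tensor_pow (kform2 b) n.+1 u = b (u k0) (u k1) *
    tensor_pow (kform2 b) n (u \o @rshift 2 (n * 2)) by [].
  by rewrite cE ub -natrM mulnb.
split=> [/andP[/andP[o0 /eqP e0] /cP H] k l|H].
  case: (split_ordP (k : 'I_(2 + n * 2))) => k' -> ek lk.
    have k'0 : k' = ord0 by apply: val_inj; case: k' ek {lk} => [[|[|]]].
    subst k'; have -> // : l = k1; exact: val_inj.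
  have [l' l'E] : exists l' : 'I_(n * 2), l = rshift 2 l'.
    case: (split_ordP (l : 'I_(2 + n * 2))) => l' lE; last by exists l'.
    by exfalso; move: lk; rewrite lE /=; have := ltn_ord l'; lia.
  rewrite l'E; apply: H; first by move: ek; rewrite /= ?negbK.
  by move: lk; rewrite l'E /=; lia.
apply/andP; split; first by have [o0 ->] := H k0 k1 isT erefl; rewrite o0 eqxx.
apply/cP => k l ek lk; apply: H; first by rewrite /= ?negbK.
by rewrite /= lk.
Qed.

End Evaluation.

Section Darboux.
Variables (R : numFieldType) (g : lieAlgType R) (eta : 'Hom(g, R^o)).
Let w := dform1 eta.

Lemma dform1C x y : w x y = - w y x.
Proof. by rewrite /w /dform1 lieC linearN opprK. Qed.
Lemma dform1Dl x y z : w (x + y) z = w x z + w y z.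
Proof. by rewrite /w /dform1 lieDl linearD opprD. Qed.
Lemma dform1Zl c x z : w (c *: x) z = c * w x z.
Proof. by rewrite /w /dform1 lieZl linearZ mulrN. Qed.
Lemma dform1Dr x y z : w z (x + y) = w z x + w z y.
Proof. by rewrite /w /dform1 lieDr linearD opprD. Qed.
Lemma dform1Zr c x z : w z (c *: x) = c * w z x.
Proof. by rewrite /w /dform1 lieZr linearZ mulrN. Qed.
Lemma dform1Nr x z : w z (- x) = - w z x.
Proof. by rewrite /w /dform1 lieNr linearN. Qed.
Lemma dform1Nl x z : w (- x) z = - w x z.
Proof. by rewrite /w /dform1 lieNl linearN. Qed.
Lemma dform1xx x : w x x = 0.
Proof. by rewrite /w /dform1 liexx linear0 oppr0. Qed.
Lemma dform1_suml (I : finType) (f : I -> g) z : w (\sum_i f i) z = \sum_i w (f i) z.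
Proof. by rewrite /w /dform1 lie_suml linear_sum -sumrN. Qed.

Lemma dim_cap_lker_eq (V : vectType R) (U : {vspace V}) (f : 'Hom(V, R^o)) x :
  x \in U -> f x != 0 -> \dim U = (\dim (U :&: lker f)).+1.
Proof.
move=> xU fx; apply/eqP; rewrite eqn_leq dim_cap_lker /= ltn_neqAle dimvS ?capvSl //.
rewrite andbT; apply: contra fx => /eqP e.
have /eqP UE : (U :&: lker f == U)%VS by rewrite eqEdim capvSl e /=.
by move: xU; rewrite -UE memv_cap memv_ker => /andP[].
Qed.

(** Split off a hyperbolic plane and continue in its orthogonal complement. *)
Lemma darboux_basis (U : {vspace g}) :
  (forall x, x \in U -> (forall y, y \in U -> w x y = 0) -> x = 0) ->
  exists n (e f : nat -> g),
  [/\ \dim U = (2 * n)%N, forall i, (i < n)%N -> e i \in U /\ f i \in U,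
      forall i j, (i < n)%N -> (j < n)%N ->
        [/\ w (e i) (f j) = (i == j)%:R, w (e i) (e j) = 0 & w (f i) (f j) = 0] &
      forall x, x \in U -> x = \sum_(i < n) (w x (f i) *: e i + w (e i) x *: f i)].
Proof.
have [m] := ubnP (\dim U); elim: m U => // m IH U dU nd.
have [U0|U0] := eqVneq U 0%VS.
  exists 0%N, (fun=> 0), (fun=> 0); split => // [|x]; first by rewrite U0 dimv0.
  by rewrite U0 memv0 big_ord0 => /eqP.
have [e0 [e0U e00]] : exists e0, e0 \in U /\ e0 <> 0.
  by exists (vpick U); split; [exact: memv_pick | apply/eqP; rewrite vpick0].
have [f0 f0U ef] : exists2 f0, f0 \in U & w e0 f0 = 1.
  have [y yU wy] : exists2 y, y \in U & w e0 y != 0.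
    apply: contrapT => ny; apply: e00; apply: nd => // y yU.
    by apply/eqP; apply: contrapT => h; apply: ny; exists y => //; apply/negP.
  exists ((w e0 y)^-1 *: y); first exact: memvZ.
  by rewrite dform1Zr mulVf.
pose le : 'Hom(g, R^o) := linfun (eta \o lie e0).
pose lf : 'Hom(g, R^o) := linfun (eta \o lie f0).
have leE x : le x = - w e0 x by rewrite lfunE /w /dform1 opprK.
have lfE x : lf x = - w f0 x by rewrite lfunE /w /dform1 opprK.
have le0 x : (le x == 0) = (w e0 x == 0) by rewrite leE oppr_eq0.
have lf0 x : (lf x == 0) = (w f0 x == 0) by rewrite lfE oppr_eq0.
pose U1 := (U :&: lker le)%VS; pose U2 := (U1 :&: lker lf)%VS.
have U2P x : x \in U2 -> [/\ x \in U, w e0 x = 0 & w f0 x = 0].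
  rewrite !memv_cap !memv_ker le0 lf0 => /andP[/andP[xU /eqP ?] /eqP ?].
  by split.
have fe : w f0 e0 = - 1 by rewrite dform1C ef.
have d1 : \dim U = (\dim U1).+1.
  by apply: (dim_cap_lker_eq f0U); rewrite leE ef oppr_eq0 oner_eq0.
have d2 : \dim U1 = (\dim U2).+1.
  apply: (@dim_cap_lker_eq _ _ _ e0); last by rewrite lfE fe opprK oner_eq0.
  by rewrite memv_cap e0U memv_ker leE dform1xx oppr0 eqxx.
pose pr x := x - (w x f0 *: e0 + w e0 x *: f0).
have prU x : x \in U -> pr x \in U2.
  move=> xU; rewrite !memv_cap !memv_ker le0 lf0.
  rewrite memvB ?memvD ?memvZ //= /pr !dform1Dr !dform1Nr.
  rewrite !dform1Dr !dform1Zr !dform1xx ef fe (dform1C f0).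
  by rewrite !mulr0 mulrN1 mulr1 !(add0r, addr0) opprK addNr subrr eqxx.
have nd2 x : x \in U2 -> (forall y, y \in U2 -> w x y = 0) -> x = 0.
  move=> xU2 h; have [xU we wf] := U2P x xU2; apply: nd => // y yU.
  have := h _ (prU y yU); rewrite /pr dform1Dr dform1Nr dform1Dr !dform1Zr.
  by rewrite (dform1C x e0) (dform1C x f0) we wf !oppr0 !mulr0 !(addr0, oppr0).
have [|n [e [f [dU2 efU efw efs]]]] := IH U2 _ nd2; first by move: dU; rewrite d1 d2; lia.
exists n.+1, (fun i => if i is i'.+1 then e i' else e0),
  (fun i => if i is i'.+1 then f i' else f0); split.
- by rewrite d1 d2 dU2; lia.
- by case=> [//|i] /efU[/U2P[? _ _] /U2P[? _ _]].
- move=> [|i] [|j] //; rewrite ?ltnS ?dform1xx ?ef //= => hi hj.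
  + by have [/U2P[_ -> _] /U2P[_ -> ->]] := efU j hj.
  + have [/U2P[_ h1 h2] /U2P[_ h3 h4]] := efU i hi.
    by rewrite !(dform1C _ e0) !(dform1C _ f0) h1 h2 h4 !oppr0.
  exact: efw.
move=> x xU; rewrite big_ord_recl /=.
apply/eqP; rewrite addrC -subr_eq -/(pr x) {1}(efs _ (prU x xU)); apply/eqP.
apply: eq_bigr => i _ /=.
have [/U2P[_ h1 h2] /U2P[_ h3 h4]] := efU i (ltn_ord i).
congr (_ *: _ + _ *: _).
  by rewrite /pr dform1Dl dform1Nl dform1Dl !dform1Zl h3 h4 !mulr0 addr0 oppr0 addr0.
by rewrite /pr dform1Dr dform1Nr dform1Dr !dform1Zr (dform1C (e i) e0) (dform1C (e i) f0)
  h1 h2 !oppr0 !mulr0 !(addr0, oppr0).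
Qed.

End Darboux.

Section NondegenerateContact.
Variables (R : numFieldType) (g : lieAlgType R) (eta : 'Hom(g, R^o)) (xi : g).
Local Notation w := (dform1 eta).

(** On the basis xi, e_0, f_0, e_1, f_1, ... with (e, f) a Darboux basis of
    ker eta, write d eta as the alternation of the form b that pairs e_i with f_i.
    Each permutation with a nonzero term maps pairs to pairs, so its sign is +1;
    the terms are nonnegative and the identity contributes 1. *)
Lemma nondegenerate_contact :
  eta xi = 1 -> (forall y, eta (lie xi y) = 0) ->
  (forall x, eta x = 0 -> (forall y, eta (lie x y) = 0) -> x = 0) ->
  contact eta.
Proof.
move=> e1 e2 nd.
have wxi y : w xi y = 0 by rewrite /dform1 e2 oppr0.
have wxir y : w y xi = 0 by rewrite dform1C wxi oppr0.
have proj0 y : y - eta y *: xi \in lker eta.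
  by rewrite memv_ker linearB linearZ /= e1 [_ *: 1]mulr1 subrr.
have ndU x : x \in lker eta -> (forall y, y \in lker eta -> w x y = 0) -> x = 0.
  rewrite memv_ker => /eqP ex h; apply: nd => // y.
  have := h _ (proj0 y); rewrite dform1Dr dform1Nr dform1Zr wxir.
  by rewrite mulr0 oppr0 addr0 => /eqP; rewrite oppr_eq0 => /eqP.
have [n [e [f [dU efU efw efs]]]] := darboux_basis ndU.
have dg : \dim {:g} = (2 * n + 1)%N.
  rewrite (@dim_cap_lker_eq _ _ fullv eta xi) ?memvf ?e1 ?oner_eq0 //.
  by rewrite capfv dU addn1.
exists n; split => //.
pose b x y := \sum_(i < n) w x (f i) * w (e i) y.
have wb x y : w x y = b x y - b y x.
  have wl z : w (x - eta x *: xi) z = w x z.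
    by rewrite [LHS]dform1Dl dform1Nl dform1Zl wxi mulr0 oppr0 addr0.
  have wr z : w z (x - eta x *: xi) = w z x.
    by rewrite [LHS]dform1Dr dform1Nr dform1Zr wxir mulr0 oppr0 addr0.
  rewrite -{1}wl (efs _ (proj0 x)) [LHS]dform1_suml -sumrB; apply: eq_bigr => i _.
  by rewrite wl wr dform1Dl !dform1Zl (dform1C _ (f i) y) (mulrC (w (e i) x))
    (mulNr (w y (f i))).
(* The index 0 is for xi, the odd 2i+1 for e_i and the even 2i+2 for f_i. *)
pose vv k := if k is 0%N then xi else if odd k then e k./2 else f (k./2).-1.
have vv_eta k : (k < (n * 2).+1)%N -> eta (vv k) = (k == 0%N)%:R.
  case: k => [_|k kn]; first by rewrite e1.
  rewrite /vv; case: ifP => o.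
    have [|+ _] := efU k.+1./2; last by rewrite memv_ker => /eqP.
    by have := odd_double_half k.+1; rewrite o; lia.
  have [|_] := efU (k.+1./2).-1; last by rewrite memv_ker => /eqP.
  by have := odd_double_half k.+1; rewrite o; lia.
have vv_b k l : (k < (n * 2).+1)%N -> (l < (n * 2).+1)%N ->
    b (vv k) (vv l) = (odd k && (l == k.+1))%:R.
  move=> kn ln; rewrite /b.
  have wf (i : 'I_n) : w (vv k) (f i) = (odd k && (k./2 == i))%:R.
    case: k kn => [|k] kn; first by rewrite wxi.
    have := odd_double_half k.+1; rewrite /vv; case: ifP => o hk.
      have kl : (k.+1./2 < n)%N by lia.
      by have [-> _ _] := efw _ _ kl (ltn_ord i).
    have kl : ((k.+1./2).-1 < n)%N by lia.
    by have [_ _ ->] := efw _ _ kl (ltn_ord i).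
  have we (i : 'I_n) : w (e i) (vv l) = (l == i.+1.*2)%:R.
    case: l ln => [|l] ln; first by rewrite wxir.
    have := odd_double_half l.+1; rewrite /vv; case: ifP => o hl.
      have ll : (l.+1./2 < n)%N by lia.
      have [_ -> _] := efw _ _ (ltn_ord i) ll.
      by case: eqP => // h; lia.
    have ll : ((l.+1./2).-1 < n)%N by lia.
    have [-> _ _] := efw _ _ (ltn_ord i) ll.
    by congr (_ %:R); congr nat_of_bool; apply/eqP/eqP => h; lia.
  under eq_bigr => i _ do rewrite wf we -natrM mulnb.
  have := odd_double_half k; case: (odd k) => hk /=; last by rewrite big1.
  have kn2 : (k./2 < n)%N by lia.
  rewrite (bigD1 (Ordinal kn2)) //= eqxx /= big1 ?addr0 => [|i]; last first.
    by rewrite -val_eqE /= eq_sym => /negPf ->.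
  by congr (_ %:R); congr nat_of_bool; apply/eqP/eqP => h; lia.
have [c c0 cE] := wedge_pow_alternation (kform2 b) n.
exists (fun k : 'I_(1 + n * 2) => vv k).
have -> : wedge_pow (kform2 (dform1 eta)) n =
    fun u => (2 ^+ n * c) * alternation (tensor_pow (kform2 b) n) u.
  by rewrite (wedge_pow_skew n wb) cE; apply/funext => u; rewrite mulrA.
rewrite wedge_alternation; apply: lt0r_neq0; rewrite mulr_gt0 //.
  by rewrite !mulr_gt0 // ?invr_gt0 ?exprn_gt0 ?ltr0n ?muln_gt0 ?fact_gt0.
pose T (s : 'S_(1 + n * 2)) := tensor (kform1 eta) (tensor_pow (kform2 b) n)
  ((fun k : 'I_(1 + n * 2) => vv k) \o s).
have TE (s : 'S_(1 + n * 2)) : exists2 c : bool, T s = ((s ord0 == ord0) && c)%:R &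
    c <-> (forall k l : 'I_(n * 2), ~~ odd k -> l = k.+1 :> nat ->
       odd (s (rshift 1 k)) /\ s (rshift 1 l) = (s (rshift 1 k)).+1 :> nat).
  have [|c' c'E c'P] := @tensor_pow_pairs _ _ b n
      (fun k : 'I_(n * 2) => vv (s (rshift 1 k))) (fun k => nat_of_ord (s (rshift 1 k))).
    by move=> k l; rewrite vv_b.
  exists c' => //; rewrite -mulnb natrM -c'E /T /tensor; congr (_ * _).
  have l0 : lshift (n * 2) (ord0 : 'I_1) = ord0 :> 'I_(n * 2).+1 by exact: val_inj.
  by rewrite /kform1 /= vv_eta ?ltn_ord // l0.
have pos (s : 'S_(1 + n * 2)) : 0 <= (-1) ^+ s * T s.
  have [c' -> c'P] := TE s; case: eqP => [s0|]; last by rewrite mulr0.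
  case: c' c'P => [[/(_ isT) h _]|_]; last by rewrite mulr0.
  rewrite mulr1 (_ : odd_perm s = false) //; apply: pair_perm_even s0 _ => i j oi ji.
  have [k kE] : exists k, i = rshift 1 k.
    by case: (split_ordP (i : 'I_(1 + n * 2))) => k kE; [rewrite kE ord1 in oi | exists k].
  have [l lE] : exists l, j = rshift 1 l.
    case: (split_ordP (j : 'I_(1 + n * 2))) => l lE; last by exists l.
    by rewrite lE ord1 in ji.
  by rewrite kE lE; apply: h; [move: oi; rewrite kE | move: ji; rewrite kE lE => -[]].
rewrite /alternation (bigD1 (1%g : 'S_(1 + n * 2))) //= ltr_wpDr //; first by apply: sumr_ge0 => s _; exact: pos.
rewrite odd_perm1 mul1r -/(T 1%g).
have [c' -> c'P] := TE 1%g; rewrite perm1 eqxx.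
suff -> : c' by rewrite ltr01.
by apply/c'P => k l ek lk; rewrite !perm1 /= lk.
Qed.

End NondegenerateContact.

(** * Construction of DS-contact Lie algebras *)

Section Extension.
Variables (R : numFieldType) (a : lieAlgType R) (k : nat).
Variables (chi : 'Hom(a, R^o)) (z : a) (c : R).

(** The decomposition a + (R xi + (R^k + R^k)). *)
Definition ext_space : vectType R := (a * (R^o * ('rV[R]_k * 'rV[R]_k)))%type.
Implicit Types X Y : ext_space.

Definition dot (p q : 'rV[R]_k) : R := (p *m q^T) 0 0.

Lemma dotC p q : dot p q = dot q p.
Proof. by rewrite /dot !mxE; apply: eq_bigr => i _; rewrite !mxE mulrC. Qed.
Lemma dotDl p p' q : dot (p + p') q = dot p q + dot p' q.
Proof. by rewrite /dot mulmxDl mxE. Qed.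
Lemma dotZl r p q : dot (r *: p) q = r * dot p q.
Proof. by rewrite /dot -scalemxAl mxE. Qed.
Lemma dotNl p q : dot (- p) q = - dot p q.
Proof. by rewrite -scaleN1r dotZl mulN1r. Qed.
Lemma dotDr p p' q : dot q (p + p') = dot q p + dot q p'.
Proof. by rewrite dotC dotDl !(dotC q). Qed.
Lemma dotZr r p q : dot q (r *: p) = r * dot q p.
Proof. by rewrite dotC dotZl dotC. Qed.
Lemma dotNr p q : dot q (- p) = - dot q p.
Proof. by rewrite dotC dotNl dotC. Qed.

Lemma dot0r p : dot p 0 = 0.
Proof. by rewrite -(scale0r (0 : 'rV_k)) dotZr mul0r. Qed.
Lemma dot0l p : dot 0 p = 0.
Proof. by rewrite dotC dot0r. Qed.

Definition dotE := (dotDl, dotDr, dotZl, dotZr, dotNl, dotNr).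

Definition psi X Y : R := dot X.2.2.1 Y.2.2.2 - dot X.2.2.2 Y.2.2.1.

Definition wtp X : R := X.2.1 + chi X.1 / 2.
Definition wtq X : R := - X.2.1 + chi X.1 / 2.

(** An element x + s xi acts on the two summands of q with the weights
    chi(x)/2 + s and chi(x)/2 - s. *)
Definition ext_bracket X Y : ext_space :=
  (lie X.1 Y.1 + psi X Y *: z,
    (c * psi X Y,
      (wtp X *: Y.2.2.1 - wtp Y *: X.2.2.1,
       wtq X *: Y.2.2.2 - wtq Y *: X.2.2.2))).

Lemma ext_bracketC X Y : ext_bracket X Y = - ext_bracket Y X.
Proof.
rewrite /ext_bracket; have -> : psi X Y = - psi Y X.
  by rewrite /psi opprB (dotC Y.2.2.1) (dotC Y.2.2.2).
congr (_, (_, (_, _))) => /=; first by rewrite lieC scaleNr opprD.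
- by rewrite mulrN.
- by rewrite opprB.
by rewrite opprB.
Qed.

Lemma ext_bracket_linearl Y : linear (ext_bracket^~ Y).
Proof.
move=> r X X'; rewrite /ext_bracket /psi /wtp /wtq /=.
congr (_, (_, (_, _))) => /=.
- rewrite lieDl lieZl scalerDr addrACA scalerA -scalerDl !dotE.
  by congr (_ + _ *: _); ring.
- by rewrite !dotE -[_ *: _ in RHS]/(r * _); ring.
- rewrite (linearP chi) /= -[r *: chi _]/(r * _) -[r *: X.2.1]/(r * _).
  by apply/rowP => i; rewrite !mxE; field.
rewrite (linearP chi) /= -[r *: chi _]/(r * _) -[r *: X.2.1]/(r * _).
by apply/rowP => i; rewrite !mxE; field.
Qed.

Lemma ext_bracket_linearr X : linear (ext_bracket X).
Proof.
by move=> r Y Y'; rewrite ext_bracketC ext_bracket_linearl opprD -scalerN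
  -!(ext_bracketC X).
Qed.

Lemma ext_bracketxx X : ext_bracket X X = 0.
Proof.
have /eqP := ext_bracketC X X; rewrite -addr_eq0 -mulr2n -scaler_nat scaler_eq0.
by rewrite pnatr_eq0 => /eqP.
Qed.

Hypothesis lie_z : forall x, lie x z = chi x *: z.
Hypothesis chi_lie : forall x y, chi (lie x y) = 0.
Hypothesis chi_z : chi z = 0.
Hypothesis c_chi : forall x, c * chi x = 0.
Hypothesis c_k : c = 0 \/ k = 1%N.

Lemma ext_bracket_chi X Y : chi (ext_bracket X Y).1 = 0.
Proof. by rewrite linearD linearZ /= chi_lie chi_z scaler0 addr0. Qed.

(** The part of the Jacobi identity in the direction of z and xi: psi is scaled
    by chi under a and is preserved by xi. *)
Lemma psi_jacobi X Y Z :
  chi X.1 * psi Y Z + psi X (ext_bracket Y Z) +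
  (chi Y.1 * psi Z X + psi Y (ext_bracket Z X)) +
  (chi Z.1 * psi X Y + psi Z (ext_bracket X Y)) = 0.
Proof.
rewrite /psi /ext_bracket /wtp /wtq /= !dotE.
case: X Y Z => [x [s [p q]]] [y [t [p' q']]] [y' [r [p'' q'']]] /=.
rewrite !(dotC q p') !(dotC q p'') !(dotC q' p) !(dotC q' p'') !(dotC q'' p) !(dotC q'' p').
move: (chi x) (chi y) (chi y') => A B C; by field; rewrite ?pnatr_eq0.
Qed.

(** For k = 1 this is the linear relation between three vectors of a plane
    whose coefficients are their pairwise determinants. *)
Lemma cyclic_psi X Y Z :
  c *: (psi Y Z *: X.2.2 + psi Z X *: Y.2.2 + psi X Y *: Z.2.2) = 0.
Proof.
case: c_k => [->|k1]; first by rewrite scale0r.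
apply/eqP; rewrite scaler_eq0; apply/orP; right; apply/eqP.
rewrite /psi; move: X Y Z => [x [s [p q]]] [y [t [p' q']]] [y' [r [p'' q'']]] /=.
have sc (u : 'rV[R]_k) : exists l, u = l *: const_mx 1.
  exists (u 0 (cast_ord (esym k1) ord0)); apply/rowP => i; rewrite !mxE mulr1; congr (u _ _).
  by apply: val_inj => /=; have := ltn_ord i; move: (i : nat) => j; rewrite k1; case: j.
have [P ->] := sc p; have [Q ->] := sc q; have [P' ->] := sc p'.
have [Q' ->] := sc q'; have [P'' ->] := sc p''; have [Q'' ->] := sc q''.
rewrite !dotE; move: (dot _ _) => d.
by congr (_, _) => /=; apply/rowP => i; rewrite !mxE; ring.
Qed.

Lemma ext_jacobi X Y Z :
  ext_bracket X (ext_bracket Y Z) + ext_bracket Y (ext_bracket Z X) +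
  ext_bracket Z (ext_bracket X Y) = 0.
Proof.
have Ep U V : wtp (ext_bracket U V) = c * psi U V.
  by rewrite /wtp ext_bracket_chi mul0r addr0.
have Eq U V : wtq (ext_bracket U V) = - (c * psi U V).
  by rewrite /wtq ext_bracket_chi mul0r addr0.
have J := psi_jacobi X Y Z.
have Jp := congr1 fst (cyclic_psi X Y Z); have Jq := congr1 snd (cyclic_psi X Y Z).
rewrite {1 3 5}/ext_bracket !Ep !Eq; congr (_, (_, (_, _))) => /=.
- rewrite !lieDr !lieZr !lie_z !scalerA.
  have sh (u u' u'' v v' v'' t t' t'' : a) : u + v + t + (u' + v' + t') +
      (u'' + v'' + t'') = u + u' + u'' + (v + t + (v' + t') + (v'' + t'')).
    by rewrite -!(addrA _ v) -!(addrA _ v') -!(addrA _ v'') (addrACA u) [LHS]addrACA.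
  rewrite sh -!scalerDl lie_jacobi add0r.
  by rewrite -[RHS](scale0r z) -J; congr (_ *: _); rewrite /psi /=; ring.
- transitivity (c * (chi X.1 * psi Y Z + psi X (ext_bracket Y Z) +
    (chi Y.1 * psi Z X + psi Y (ext_bracket Z X)) +
    (chi Z.1 * psi X Y + psi Z (ext_bracket X Y))) -
    (c * chi X.1 * psi Y Z + c * chi Y.1 * psi Z X + c * chi Z.1 * psi X Y)).
    by rewrite /psi /=; ring.
  by rewrite J !c_chi !mul0r mulr0 !addr0 subr0.
- apply/rowP => i; have /rowP/(_ i) := Jp; rewrite !mxE /= => Jpi.
  by rewrite -[RHS]oppr0 -Jpi; ring.
apply/rowP => i; have /rowP/(_ i) := Jq; rewrite !mxE /= => Jqi.
by rewrite -Jqi; ring.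
Qed.

Definition extension : lieAlgType R := HB.pack (Vector.sort ext_space) ext_space
  (Vector_isLieAlgebra.Build R ext_space ext_bracket_linearl ext_bracket_linearr
    ext_bracketxx ext_jacobi).

Variables (lam : 'Hom(a, R^o)).
Hypothesis lam_nondeg : forall x, (forall y, lam (lie x y) = 0) -> x = 0.
Hypothesis c_lam : c - lam z != 0.

Local Notation L := extension.

Definition ext_xi : L := (0, (1, (0, 0))).
Definition ext_eta_fun (X : L) : R^o := X.2.1 - lam X.1.
(** The isomorphism of a with t_0: lambda(x) xi corrects x so that it falls
    into the kernel of eta = xi^* - lambda. *)
Definition ext_lift_fun (x : a) : L := (x, (lam x, (0, 0))).
Definition ext_inj_fun (u : 'rV[R]_k * 'rV[R]_k) : L := (0, (0, u)).

Lemma ext_eta_linear : linear ext_eta_fun.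
Proof.
move=> r X Y; rewrite /ext_eta_fun (linearP lam) /= opprD addrACA scalerBr.
by [].
Qed.
HB.instance Definition _ := GRing.isLinear.Build R L R^o *:%R ext_eta_fun ext_eta_linear.

Lemma ext_lift_linear : linear ext_lift_fun.
Proof.
move=> r x y; rewrite /ext_lift_fun (linearP lam).
by congr (_, (_, (_, _))); rewrite /= scaler0 addr0.
Qed.
HB.instance Definition _ := GRing.isLinear.Build R a L *:%R ext_lift_fun ext_lift_linear.

Lemma ext_inj_linear : linear ext_inj_fun.
Proof.
by move=> r x y; congr (_, (_, _)); rewrite /= scaler0 addr0.
Qed.
HB.instance Definition _ := GRing.isLinear.Build R _ L *:%R ext_inj_fun ext_inj_linear.

Definition ext_eta : 'Hom(L, R^o) := linfun ext_eta_fun.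

Lemma ext_etaE (X : L) : ext_eta X = X.2.1 - lam X.1.
Proof. by rewrite lfunE. Qed.

Lemma ext_eta_lie (X Y : L) : ext_eta (lie X Y) = (c - lam z) * psi X Y - lam (lie X.1 Y.1).
Proof.
rewrite ext_etaE /= linearD linearZ /= -[_ *: lam z]/(_ * _).
by ring.
Qed.

Lemma lie_ext_xi (Y : L) : lie ext_xi Y = (0, (0, (Y.2.2.1, - Y.2.2.2))) :> L.
Proof.
rewrite [LHS]/(ext_bracket _ _) /ext_bracket /psi /wtp /wtq /=.
rewrite lie0l linear0 mul0r !addr0 !scaler0 !subr0 scale1r scaleN1r.
by rewrite !dot0l subrr mulr0 !scale0r add0r.
Qed.

Lemma ext_eta_xi : ext_eta ext_xi = 1.
Proof. by rewrite ext_etaE /= linear0 subr0. Qed.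

Lemma ext_eta_lie_xi (Y : L) : ext_eta (lie ext_xi Y) = 0.
Proof. by rewrite lie_ext_xi ext_etaE /= linear0 subr0. Qed.

Lemma dot_delta p i : dot p (delta_mx 0 i) = p 0 i.
Proof.
rewrite /dot trmx_delta mxE (bigD1 i) //= big1 => [|j ji]; rewrite !mxE !eqxx.
  by rewrite mulr1 addr0.
by rewrite (negPf ji) mulr0.
Qed.

Lemma ext_contact : contact ext_eta.
Proof.
apply: (nondegenerate_contact ext_eta_xi ext_eta_lie_xi) => -[x [s [p q]]] e h.
have psi0 u : psi (x, (s, (p, q))) (0, (0, u)) = 0.
  have /eqP := h (0, (0, u)); rewrite ext_eta_lie /= lie0r linear0 subr0.
  by rewrite mulf_eq0 (negPf c_lam) => /eqP.
have p0 : p = 0.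
  apply/rowP => i; have := psi0 (0, delta_mx 0 i).
  by rewrite /psi /= dot0r subr0 dot_delta mxE.
have q0 : q = 0.
  apply/rowP => i; have := psi0 (delta_mx 0 i, 0).
  by rewrite /psi /= dot0r sub0r dot_delta mxE => /eqP; rewrite oppr_eq0 => /eqP.
have x0 : x = 0.
  apply: lam_nondeg => y; have := h (y, (0, (0, 0))).
  by rewrite ext_eta_lie /psi /= !dot0r subrr mulr0 sub0r => /eqP; rewrite oppr_eq0 => /eqP.
move: e; rewrite ext_etaE /= x0 linear0 subr0 => ->.
by rewrite p0 q0.
Qed.

Lemma mem_ext_tspace (X : L) : (X \in tspace ext_xi) = (X.2.2 == 0).
Proof.
rewrite memv_ker lfunE /= lie_ext_xi; case: X => [x [s [p q]]] /=.
by rewrite !xpair_eqE !eqxx /= oppr_eq0.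
Qed.

Lemma mem_ext_qspace (X : L) : (X \in qspace ext_xi) = (X.1 == 0) && (X.2.1 == 0).
Proof.
have adE (Y : L) : ad ext_xi Y = (0, (0, (Y.2.2.1, - Y.2.2.2))) :> L.
  by rewrite lfunE [LHS]lie_ext_xi.
apply/memv_imgP/andP => [[Y _ ->]|]; first by rewrite adE !eqxx.
case: X => [x [s [p q]]] /= [/eqP -> /eqP ->].
exists (0, (0, (p, - q))); first exact: memvf.
by rewrite adE /= opprK.
Qed.

Lemma dim_ext_qspace : \dim (qspace ext_xi) = (2 * k)%N.
Proof.
have -> : qspace ext_xi = limg (linfun ext_inj_fun).
  apply/vspaceP => X; rewrite mem_ext_qspace; apply/andP/memv_imgP.
    case: X => [x [s u]] /= [/eqP -> /eqP ->]; exists u; first exact: memvf.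
    by rewrite lfunE.
  by move=> [u _ ->]; rewrite lfunE.
rewrite limg_dim_eq; last first.
  apply/eqP; rewrite -subv0 capfv; apply/subvP => u.
  by rewrite memv_ker lfunE /= memv0 /ext_inj_fun xpair_eqE => /andP[_]; rewrite xpair_eqE => /andP[].
rewrite dimvf -[LHS]/(dim 'rV[R]_k + dim 'rV[R]_k)%N.
have -> : dim 'rV[R]_k = k by rewrite dim_matrix; exact: mul1n.
by rewrite addnn mul2n.
Qed.

Lemma ext_realizable (w : a -> a -> R) :
  (forall x y, w x y = dform1 lam x y) -> realizable w (2 * k).
Proof.
move=> wE; exists L, ext_eta, ext_xi; split; [|exact: dim_ext_qspace|].
  split; [exact: ext_contact| | |].
  - by split=> [|y]; [exact: ext_eta_xi | rewrite /dform1 ext_eta_lie_xi oppr0].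
  - apply/eqP; rewrite eqEsubv subvf; apply/subvP => -[x [s u]] _.
    have -> : (x, (s, u)) = (x, (s, 0)) + (0, (0, u)) :> L.
      by congr (_, (_, _)); rewrite /= ?addr0 ?add0r.
    by apply: memv_add; rewrite (mem_ext_tspace, mem_ext_qspace) /= ?eqxx.
  apply/directv_addP/eqP; rewrite -subv0; apply/subvP => X.
  rewrite memv_cap mem_ext_tspace mem_ext_qspace memv0.
  by case: X => [x [s u]] /= /andP[/eqP -> /andP[/eqP -> /eqP ->]].
pose t0 := t0space ext_eta ext_xi.
have liftt x : ext_lift_fun x \in t0.
  by rewrite memv_cap mem_ext_tspace memv_ker ext_etaE /= subrr !eqxx.
have cap0 : (t0 :&: <[ext_xi]> = 0)%VS.
  apply/eqP; rewrite -subv0; apply/subvP => X; rewrite !memv_cap => /andP[/andP[_]].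
  rewrite memv_ker => + /vlineP[r XE]; rewrite XE linearZ /= ext_eta_xi.
  by rewrite -[_ *: 1]/(r * 1) mulr1 => /eqP ->; rewrite scale0r mem0v.
have pixi : daddv_pi t0 <[ext_xi]> ext_xi = 0.
  have xV := memv_line ext_xi.
  have := daddv_pi_add cap0 (subvP (addvSr t0 _) _ xV).
  rewrite [X in _ + X]daddv_pi_id //; last by rewrite capvC.
  by move/(canRL (addrK _)); rewrite subrr.
exists (linfun (vsproj t0 \o ext_lift_fun)).
have fE x : vsval (linfun (vsproj t0 \o ext_lift_fun) x) = ext_lift_fun x.
  by rewrite lfunE /= vsprojK.
have lieE x y : lie (ext_lift_fun x) (ext_lift_fun y) =
    ext_lift_fun (lie x y) - lam (lie x y) *: ext_xi :> L.
  rewrite [LHS]/(ext_bracket _ _) /ext_bracket /psi /= !dot0r subrr mulr0 scale0r addr0.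
  congr (_, (_, (_, _))) => /=; rewrite ?scaler0 ?oppr0 ?addr0 ?subr0 //.
  by rewrite -[_ *: 1]/(_ * _) mulr1 subrr.
split=> [|x y|x y].
- exists (fun y : subvs_of t0 => (vsval y : L).1) => [x|y]; first by rewrite fE.
  apply: subvs_inj; rewrite fE; have := subvsP y; move: (vsval y) => Y.
  rewrite memv_cap mem_ext_tspace memv_ker ext_etaE.
  by case: Y => [x [s u]] /= /andP[/eqP ->]; rewrite subr_eq0 => /eqP ->.
- apply: subvs_inj; rewrite fE /t0_lie vsprojK ?memv_pi //.
  by rewrite !fE lieE linearB linearZ /= pixi scaler0 subr0 daddv_pi_id.
rewrite wE /omega_t /dform1 !fE opprK ext_eta_lie /psi /= !dot0r.
by rewrite subrr mulr0 sub0r.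
Qed.

End Extension.

Section FrobeniusRealizable.
Variables (R : numFieldType) (a : lieAlgType R) (w : a -> a -> R).
Hypothesis w_frob : frobenius w.

Lemma frobenius_primitive : exists l : 'Hom(a, R^o),
  (forall x y, w x y = dform1 l x y) /\
  (forall x, (forall y, l (lie x y) = 0) -> x = 0).
Proof.
have [nd [l wl]] := w_frob; exists l; split => // x lx.
by apply: nd => y; rewrite wl /dform1 lx oppr0.
Qed.

(** The product of a with sl_2. *)
Lemma realizable_2 : realizable w 2.
Proof.
have [l [wl nd]] := frobenius_primitive.
apply: (@ext_realizable _ a 1 0 0 1 _ _ _ _ _ l) => // [x|x y||x||].
- by rewrite lie0r scaler0.
- by rewrite zero_lfunE.
- by rewrite zero_lfunE.
- by rewrite zero_lfunE mulr0.
- by right.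
by rewrite linear0 subr0 oner_eq0.
Qed.

(** The character by which a acts on a spanning vector z of J is
    l([x, z]) / l(z).  Here l(z) <> 0, for otherwise z would be in the radical of
    the exact form w. *)
Lemma realizable_line_ideal (J : {vspace a}) k :
  is_ideal J -> \dim J = 1%N -> realizable w (2 * k).
Proof.
move=> idJ dJ; have [l [wl nd]] := frobenius_primitive.
pose z := vpick J; have zJ : z \in J := memv_pick J.
have z0 : z != 0 by rewrite vpick0 -dimv_eq0 dJ.
have JE : J = <[z]>%VS.
  by apply/eqP; rewrite eq_sym eqEdim -memvE zJ dJ dim_vline z0.
have lz : l z != 0.
  have lieJ x : exists r, lie x z = r *: z.
    by apply/vlineP; rewrite -JE; exact: idJ.
  apply: contra_neq z0 => lz; apply: nd => y; have [r yz] := lieJ y.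
  by rewrite lieC yz linearN linearZ /= lz scaler0 oppr0.
pose chi : 'Hom(a, R^o) := (l z)^-1 *: linfun (l \o lier z).
have chiE x : chi x = (l z)^-1 * l (lie x z) by rewrite scale_lfunE lfunE.
have lie_z x : lie x z = chi x *: z.
  have /vlineP[r xz] : lie x z \in <[z]>%VS by rewrite -JE; exact: idJ.
  by rewrite chiE xz linearZ /= -[_ *: l z]/(_ * _) mulrCA mulVf ?mulr1.
apply: (@ext_realizable _ a k chi z 0 lie_z _ _ _ _ l) => // [x y||x||].
- have := lie_leibniz x y z; rewrite !lie_z !lieZr !lie_z !scalerA mulrC.
  rewrite -[LHS]add0r => /addIr/esym/eqP.
  by rewrite scaler_eq0 (negPf z0) orbF => /eqP.
- by rewrite chiE liexx linear0 mulr0.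
- by rewrite mul0r.
- by left.
by rewrite sub0r oppr_eq0.
Qed.

End FrobeniusRealizable.

(** * The obstruction *)

Section SubLieAlgebra.
Variables (R : fieldType) (g : lieAlgType R) (U : {vspace g}).
Hypothesis lieU : forall x y, x \in U -> y \in U -> lie x y \in U.

Definition sub_lie (x y : subvs_of U) : subvs_of U :=
  vsproj U (lie (vsval x) (vsval y)).

Lemma sub_lieE x y : vsval (sub_lie x y) = lie (vsval x) (vsval y).
Proof. by rewrite vsprojK ?lieU ?subvsP. Qed.

Lemma sub_lie_linearl y : linear (sub_lie^~ y).
Proof.
move=> c x x'; apply: subvs_inj; rewrite linearP /= !sub_lieE linearP.
by rewrite lieDl lieZl.
Qed.

Lemma sub_lie_linearr x : linear (sub_lie x).
Proof.
move=> c y y'; apply: subvs_inj; rewrite linearP /= !sub_lieE.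
by rewrite -lieZr -lieDr.
Qed.

Lemma sub_liexx x : sub_lie x x = 0.
Proof. by apply: subvs_inj; rewrite sub_lieE liexx linear0. Qed.

Lemma sub_lie_jacobi x y z :
  sub_lie x (sub_lie y z) + sub_lie y (sub_lie z x) + sub_lie z (sub_lie x y) = 0.
Proof. by apply: subvs_inj; rewrite !linearD /= !sub_lieE lie_jacobi. Qed.

Definition sub_lie_algebra : lieAlgType R := HB.pack (subvs_of U)
  (Vector_isLieAlgebra.Build R (subvs_of U) sub_lie_linearl sub_lie_linearr
    sub_liexx sub_lie_jacobi).

End SubLieAlgebra.

Lemma nu_le (R : fieldType) (g : lieAlgType R) (J : {vspace g}) :
  is_ideal J -> J != 0%VS -> (nu g <= \dim J)%N.
Proof.
move=> idJ J0; pose S := @nonzero_ideal_dims R g.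
have SJ : S (\dim J) by exists J.
rewrite /nu; case: xgetP => [m _ [_ mmin]|no]; first exact: mmin.
exfalso; have : exists m, `[< S m >] by exists (\dim J); apply/asboolP.
case/ex_minnP => m /asboolP Sm mmin; apply: (no m); split => // m' Sm'.
by apply: mmin; apply/asboolP.
Qed.

(** The pairing l([x, z]) between a complement of ker B and the span of phi is
    nondegenerate in z, because ker B is orthogonal to that span. *)
Lemma dim_span_pairing (R : fieldType) (a : lieAlgType R) (l : 'Hom(a, R^o))
    (I : finType) (phi : I -> a) (V : vectType R) (B : 'Hom(a, V)) :
  (forall x, (forall y, l (lie x y) = 0) -> x = 0) ->
  (forall x, B x = 0 -> forall i, l (lie x (phi i)) = 0) ->
  (\dim <<[seq phi i | i : I]>> <= \dim (limg B))%N.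
Proof.
move=> nd BP; set J := <<_>>%VS.
have kerJ x z : B x = 0 -> z \in J -> l (lie x z) = 0.
  move=> Bx; suff /subvP sJ : (J <= lker (linfun (l \o lie x) : 'Hom(a, R^o)))%VS.
    by move/sJ; rewrite memv_ker lfunE => /eqP.
  by apply/span_subvP => y /mapP[i _ ->]; rewrite memv_ker lfunE /= (BP _ Bx) eqxx.
pose K := ((lker B)^C)%VS.
have dK : \dim K = \dim (limg B).
  by rewrite dimv_compl -(limg_ker_dim B fullv) capfv addKn.
pose T (z : a) : 'rV[R]_(\dim K) := \row_i l (lie (vbasis K)`_i z).
have T_lin : linear T.
  by move=> c x y; apply/rowP => i; rewrite !mxE lieDr lieZr linearP.
pose T' : {linear a -> 'rV[R]_(\dim K)} :=
  HB.pack T (GRing.isLinear.Build R a 'rV[R]_(\dim K) *:%R T T_lin).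
rewrite -dK -(@limg_dim_eq _ _ _ (linfun T') J).
  apply: leq_trans (dimvS (subvf _)) _; rewrite dimvf dim_matrix.
  by rewrite [X in (X <= _)%N]mul1n.
apply/eqP; rewrite -subv0; apply/subvP => z; rewrite memv_cap memv_ker lfunE memv0.
move=> /andP[zJ /eqP Tz]; apply/eqP/nd => y; rewrite lieC linearN /=.
have : y \in (lker B + K)%VS by rewrite addv_complf memvf.
case/memv_addP => y1; rewrite memv_ker => /eqP By1 [y2 y2K ->].
rewrite lieDl linearD /= (kerJ _ _ By1 zJ) add0r (coord_vbasis y2K) lie_suml linear_sum.
rewrite big1 ?oppr0 // => i _; rewrite lieZl linearZ /=.
have := congr1 (fun v : 'rV_ _ => v 0 i) Tz; rewrite /= !mxE => ->.
by rewrite scaler0.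
Qed.

Section Realization.
Variables (R : numFieldType) (C : numClosedFieldType) (iota : {rmorphism R -> C}).
Variables (a : lieAlgType R) (w : a -> a -> R) (l : 'Hom(a, R^o)).
Hypothesis w_l : forall x y, w x y = dform1 l x y.
Hypothesis l_nondeg : forall x, (forall y, l (lie x y) = 0) -> x = 0.
Variables (g : lieAlgType R) (eta : 'Hom(g, R^o)) (xi : g).
Hypothesis ds : ds_contact eta xi.
Variable f : 'Hom(a, subvs_of (t0space eta xi)).
Hypothesis f_bij : bijective f.
Hypothesis f_lie : forall x y, f (lie x y) = t0_lie (f x) (f y).
Hypothesis f_omega : forall x y, omega_t (f x) (f y) = w x y.

Local Notation t := (tspace xi).
Local Notation q := (qspace xi).
Local Notation t0 := (t0space eta xi).

Let eta_xi : eta xi = 1. Proof. by have [_ []] := ds. Qed.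

Let eta_lie_xi y : eta (lie xi y) = 0.
Proof.
have [_ [_ h] _ _] := ds; have /eqP := h y.
by rewrite oppr_eq0 => /eqP.
Qed.

Let mem_t x : (x \in t) = (lie xi x == 0).
Proof. by rewrite memv_ker lfunE. Qed.

Let lie_xi_q x : lie xi x \in q.
Proof. by apply/memv_imgP; exists x; rewrite ?memvf ?lfunE. Qed.

Let q_lie u : u \in q -> exists v, u = lie xi v.
Proof. by move=> /memv_imgP[v _ ->]; exists v; rewrite lfunE. Qed.

Let eta_q u : u \in q -> eta u = 0.
Proof. by move=> /q_lie[v ->]. Qed.

Let lie_tq x u : x \in t -> u \in q -> lie x u \in q.
Proof.
rewrite mem_t => /eqP xt /q_lie[v ->].
by rewrite lie_leibniz (lieC x xi) xt oppr0 lie0l add0r.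
Qed.

Let t_cap_q x : x \in t -> x \in q -> x = 0.
Proof.
have [_ _ _ /directv_addP tq] := ds => xt xq.
by apply/eqP; rewrite -memv0 -tq memv_cap xt.
Qed.

Let F x : g := vsval (f x).

Let F_t x : F x \in t.
Proof. by have := subvsP (f x); rewrite memv_cap => /andP[]. Qed.

Let eta_F x : eta (F x) = 0.
Proof. by have := subvsP (f x); rewrite memv_cap memv_ker => /andP[_ /eqP]. Qed.

Let H : {vspace g} := (<[xi]> + q)%VS.

Let xi_t : xi \in t. Proof. by rewrite mem_t liexx. Qed.

Let H_P y : y \in H -> exists s u, u \in q /\ y = s *: xi + u.
Proof. by move=> /memv_addP[v /vlineP[s ->] [u uq ->]]; exists s, u. Qed.

Let H_I s u : u \in q -> s *: xi + u \in H.
Proof. by move=> uq; rewrite memv_add // memvZ // memv_line. Qed.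

Let q_H u : u \in q -> u \in H.
Proof. by move=> uq; rewrite -[u]add0r -(scale0r xi) H_I. Qed.

Let xi_H : xi \in H.
Proof. by rewrite -[xi]addr0 -(scale1r xi) H_I ?mem0v. Qed.

Let t0_cap_H : (t0 :&: H = 0)%VS.
Proof.
apply/eqP; rewrite -subv0; apply/subvP => y; rewrite !memv_cap => /andP[/andP[yt]].
rewrite memv_ker => ey /H_P[s [u [uq yE]]]; move: ey yt; rewrite yE linearD linearZ /=.
rewrite eta_xi eta_q // addr0 -[_ *: 1]/(s * 1) mulr1 => /eqP ->; rewrite scale0r add0r.
by move=> ut; rewrite (t_cap_q ut uq) mem0v.
Qed.

Let decomp y : exists x h, h \in H /\ y = F x + h.
Proof.
have [_ _ full _] := ds; have : y \in (t + q)%VS by rewrite full memvf.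
case/memv_addP => v vt [u uq ->].
have v0 : v - eta v *: xi \in t0.
  rewrite memv_cap memvB ?memvZ // memv_ker linearB linearZ /= eta_xi.
  by rewrite -[_ *: 1]/(eta v * 1) mulr1 subrr eqxx.
have [f' f'K fK] := f_bij.
exists (f' (vsproj t0 (v - eta v *: xi))), (eta v *: xi + u); split; first exact: H_I.
by rewrite /F fK vsprojK // addrA subrK.
Qed.

(** The projection of g onto t_0, identified with a, along R xi + q. *)
Let P : 'Hom(g, a) :=
  (f^-1 \o (linfun (vsproj t0) \o daddv_pi t0 H))%VF.

Let P_E x h : h \in H -> P (F x + h) = x.
Proof.
move=> hH; rewrite !comp_lfunE linearD /=.
rewrite daddv_pi_id ?t0_cap_H ?subvsP //.
have -> : daddv_pi t0 H h = 0.
  have := daddv_pi_add t0_cap_H (subvP (addvSr t0 _) _ hH).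
  rewrite [X in _ + X]daddv_pi_id //; last by rewrite capvC t0_cap_H.
  by move/(canRL (addrK _)); rewrite subrr.
rewrite addr0 lfunE /= vsvalK lker0_lfunK //; apply/lker0P; exact: bij_inj.
Qed.

Let F0 : F 0 = 0. Proof. by rewrite /F linear0. Qed.

Let P_H h : h \in H -> P h = 0.
Proof. by move=> hH; rewrite -[h]add0r -F0 P_E. Qed.

(** The t_0-component of the bracket is the bracket of a, and its component
    along xi is read off with eta. *)
Let lie_F x y : lie (F x) (F y) = F (lie x y) + w x y *: xi.
Proof.
set Y := lie (F x) (F y).
have Yt : Y \in t.
  have := F_t x; have := F_t y; rewrite !mem_t => /eqP hy /eqP hx.
  by rewrite lie_leibniz hx hy lie0l lie0r addr0.
have etaY : eta Y = w x y by rewrite -f_omega /omega_t /dform1 opprK.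
have Y0 : Y - eta Y *: xi \in t0.
  rewrite memv_cap memvB ?memvZ // memv_ker linearB linearZ /= eta_xi.
  by rewrite -[_ *: 1]/(eta Y * 1) mulr1 subrr eqxx.
rewrite -etaY /F f_lie /t0_lie vsprojK ?memv_pi // -/(F x) -/(F y) -/Y.
have cap0 : (t0 :&: <[xi]> = 0)%VS.
  by apply/eqP; rewrite -subv0 -t0_cap_H capvS // addvSl.
have pixi : daddv_pi t0 <[xi]> xi = 0.
  have := daddv_pi_add cap0 (subvP (addvSr t0 _) _ (memv_line xi)).
  rewrite [X in _ + X]daddv_pi_id ?memv_line //; last by rewrite capvC.
  by move/(canRL (addrK _)); rewrite subrr.
have -> : daddv_pi t0 <[xi]> Y = Y - eta Y *: xi; last by rewrite subrK.
rewrite -[X in daddv_pi _ _ X](subrK (eta Y *: xi)) (linearD (daddv_pi _ _)).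
by rewrite [X in _ + X]linearZ /= pixi scaler0 addr0 daddv_pi_id.
Qed.

Let lie_FH x h : h \in H -> lie (F x) h \in q.
Proof.
move=> /H_P[s [u [uq ->]]]; rewrite lieDr lieZr.
have := F_t x; rewrite mem_t => /eqP xF; rewrite (lieC (F x)) xF oppr0 scaler0 add0r.
exact: lie_tq.
Qed.

(** The subspace R xi + q is stable under t_0, so the projection P intertwines
    the actions of t_0 on g and of a on itself. *)
Let P_lie x Y : P (lie (F x) Y) = lie x (P Y).
Proof.
have [y [h [hH ->]]] := decomp Y; rewrite P_E // lieDr lie_F -addrA P_E //.
by rewrite H_I // lie_FH.
Qed.

Let eta_lie x Y : eta (lie (F x) Y) = w x (P Y).
Proof.
have [y [h [hH ->]]] := decomp Y; rewrite P_E // lieDr lie_F !linearD linearZ /=.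
by rewrite eta_F eta_xi (eta_q (lie_FH _ hH)) addr0 add0r -[_ *: 1]/(_ * 1) mulr1.
Qed.

Local Notation N := (\dim q).
Let b (i : 'I_N) : g := (vbasis q)`_i.
Let b_q i : b i \in q.
Proof. by apply/vbasis_mem/mem_nth; rewrite size_tuple. Qed.
Let b_E u : u \in q -> u = \sum_i coord (vbasis q) i u *: b i.
Proof. exact: coord_vbasis. Qed.

Let phi (ij : 'I_N * 'I_N) : a := P (lie (b ij.1) (b ij.2)).

Let J : {vspace a} := <<[seq phi ij | ij : 'I_N * 'I_N]>>%VS.

Let phi_J u v : u \in q -> v \in q -> P (lie u v) \in J.
Proof.
move=> /b_E -> /b_E ->; rewrite lie_suml linear_sum memv_suml // => i _.
rewrite lieZl lie_sumr linearZ memvZ //= linear_sum memv_suml // => j _.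
rewrite lieZr linearZ memvZ //=; apply: memv_span; apply/mapP.
by exists (i, j) => //; rewrite mem_enum.
Qed.

(** By [P_lie] and the Leibniz rule, [x, P [u, v]] is again a sum of vectors
    P [u', v'] with u', v' in q. *)
Let J_ideal : is_ideal J.
Proof.
move=> x y yJ; have /subvP sJ : (J <= (linfun (lie x) @^-1: J))%VS; last first.
  by have := sJ _ yJ; rewrite -memv_preim lfunE.
apply/span_subvP => z /mapP[[i j] _ ->]; rewrite -memv_preim lfunE /= /phi /=.
by rewrite -P_lie lie_leibniz linearD memvD // phi_J ?b_q // lie_tq.
Qed.

Let D : 'M[R]_N := \matrix_(i, j) coord (vbasis q) j (lie xi (b i)).

Let D_E i : lie xi (b i) = \sum_j D i j *: b j.
Proof. by rewrite {1}(b_E (lie_xi_q _)); apply: eq_bigr => j _; rewrite mxE. Qed.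

(** The kernel of ad xi is t, which meets q trivially. *)
Let D_unit : D \in unitmx.
Proof.
rewrite -row_free_unit; apply: inj_row_free => v vD.
pose u := \sum_i v 0 i *: b i.
have uq : u \in q by apply: memv_suml => i _; rewrite memvZ.
have u0 : u = 0.
  apply: t_cap_q => //; rewrite mem_t /u lie_sumr.
  under eq_bigr => i _ do rewrite lieZr D_E scaler_sumr.
  rewrite exchange_big /= big1 // => j _.
  under eq_bigr => i _ do rewrite scalerA.
  have := congr1 (fun A : 'rV_ _ => A 0 j) vD; rewrite !mxE => E.
  by rewrite -scaler_suml E scale0r.
have /freeP fr := basis_free (vbasisP q).
by apply/rowP => i; rewrite mxE; apply: (fr (fun i => v 0 i)).
Qed.

Let B_fun (x : a) : 'M[R]_N := \matrix_(i, j) eta (lie (F x) (lie (b i) (b j))).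
Let B_lin : linear B_fun.
Proof.
move=> c x y; apply/matrixP => i j; rewrite !mxE.
by rewrite /F linearP /= lieDl lieZl linearP.
Qed.

(** Invariance under ad xi: the Leibniz rule reduces it to
    eta([x, [xi, y]]) = w(x, P [xi, y]), and [xi, y] lies in q. *)
Let B_skew x : skew_invariant D (B_fun x).
Proof.
split; first by apply/matrixP => i j; rewrite !mxE (lieC (b j)) lieNr linearN.
apply/matrixP => i j; rewrite [LHS]mxE [RHS]mxE [X in - X]mxE.
have -> : \sum_k D i k * B_fun x k j = eta (lie (F x) (lie (lie xi (b i)) (b j))).
  rewrite D_E lie_suml lie_sumr linear_sum; apply: eq_bigr => k _.
  by rewrite [B_fun _ _ _]mxE lieZl lieZr linearZ.
have -> : \sum_k B_fun x i k * D^T k j = eta (lie (F x) (lie (b i) (lie xi (b j)))).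
  rewrite D_E !lie_sumr linear_sum; apply: eq_bigr => k _.
  by rewrite [B_fun _ _ _]mxE [D^T _ _]mxE !lieZr linearZ mulrC.
apply/eqP; rewrite -subr_eq0 opprK -(linearD eta) -lieDr -lie_leibniz; apply/eqP.
rewrite [LHS]eta_lie P_H.
  by rewrite w_l /dform1 lie0r linear0 oppr0.
exact/q_H/lie_xi_q.
Qed.

(** The form B x has the values w(x, P [u, v]), so that the pairing w bounds
    dim J by the dimension of the space of all forms B x. *)
Let dim_J : (\dim J <= N./2 * uphalf N)%N.
Proof.
pose B' : {linear a -> 'M[R]_N} :=
  HB.pack B_fun (GRing.isLinear.Build R a 'M[R]_N *:%R B_fun B_lin).
apply: leq_trans (_ : _ <= \dim (limg (linfun B')))%N _.
  apply: dim_span_pairing l_nondeg _ => x; rewrite lfunE /= => Bx [i j].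
  have := congr1 (fun A : 'M_ _ => A i j) Bx; rewrite !mxE eta_lie w_l.
  by rewrite /dform1 => /eqP; rewrite oppr_eq0 => /eqP.
apply: (skew_invariant_dim_subfield iota D_unit) => M /memv_imgP[x _ ->].
by rewrite lfunE; exact: B_skew.
Qed.

(** If J = 0 then R xi + q is closed under the bracket.  It inherits the contact
    condition because q is orthogonal to t_0 for d eta, and in it only multiples of
    xi commute with xi; so its dimension 1 + dim q is at most 3. *)
Let ideal_zero_dim : J = 0%VS -> (N <= 2)%N.
Proof.
move=> J0.
have lieq u v : u \in q -> v \in q -> lie u v \in H.
  move=> uq vq; have := phi_J uq vq; rewrite J0 memv0.
  have [x [h [hH ->]]] := decomp (lie u v); rewrite P_E // => /eqP ->.
  by rewrite F0 add0r.
have lieH x y : x \in H -> y \in H -> lie x y \in H.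
  move=> /H_P[s [u [uq ->]]] /H_P[s' [v [vq ->]]].
  rewrite lieDl !lieDr !lieZl !lieZr liexx !scaler0 add0r.
  apply: memvD; first by rewrite memvZ ?q_H ?lie_xi_q.
  by apply: memvD; [rewrite memvZ // lieC memvN q_H ?lie_xi_q | exact: lieq].
pose h : lieAlgType R := sub_lie_algebra lieH.
pose etah : 'Hom(h, R^o) := linfun (eta \o vsval : h -> R^o).
pose xih : h := vsproj H xi.
have vxi : vsval xih = xi by rewrite vsprojK.
have lieE (x y : h) : vsval (lie x y) = lie (vsval x) (vsval y) by exact: sub_lieE.
have etaE (x : h) : etah x = eta (vsval x) by rewrite lfunE.
have dh : \dim {:h} = N.+1.
  have -> : \dim {:h} = \dim H by rewrite dimvf.
  rewrite dimv_disjoint_sum ?dim_vline.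
    by case: eqP => // x0; move: eta_xi; rewrite x0 linear0 => /eqP; rewrite eq_sym oner_eq0.
  apply/eqP; rewrite -subv0; apply/subvP => y; rewrite memv_cap => /andP[/vlineP[s ->] yq].
  by rewrite (@t_cap_q (s *: xi)) ?mem0v // memvZ.
have nd := contact_nondegenerate (let: And4 c _ _ _ := ds in c).
have := @rank_one_dim_subfield R C iota h etah xih; rewrite dh ltnS; apply.
- by rewrite etaE vxi.
- by move=> y; rewrite etaE lieE vxi.
- move=> x x0; apply: subvs_inj; rewrite linearZ /= etaE vxi.
  have [s [u [uq xE]]] := H_P (subvsP x).
  have : lie xi (vsval x) = 0 by rewrite -vxi -lieE x0.
  rewrite xE lieDr lieZr liexx scaler0 add0r => xu.
  have -> : u = 0 by apply: t_cap_q => //; rewrite mem_t xu.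
  by rewrite addr0 linearZ /= eta_xi -[_ *: 1]/(s * 1) mulr1.
move=> x xr; apply: subvs_inj; rewrite linearZ /= etaE vxi.
have [s [u [uq xE]]] := H_P (subvsP x).
have u0 : u = 0.
  apply: nd => [|Y]; first exact: eta_q.
  have [y [z [zH ->]]] := decomp Y; rewrite lieDr linearD /= lieC linearN /=.
  rewrite (eta_q (lie_tq (F_t y) uq)) oppr0 add0r.
  have := xr (vsproj H z); rewrite etaE lieE vsprojK // xE lieDl lieZl linearD linearZ /=.
  by rewrite eta_lie_xi scaler0 add0r.
by rewrite xE u0 addr0 linearZ /= eta_xi -[_ *: 1]/(s * 1) mulr1.
Qed.

Lemma realization_bound : (2 < N)%N -> (nu a <= N./2 * uphalf N)%N.
Proof.
move=> N2; apply: leq_trans dim_J; apply: (nu_le J_ideal).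
by apply: contraTneq N2 => /ideal_zero_dim; rewrite -leqNgt.
Qed.

End Realization.

(** * The three assertions *)

Local Open Scope classical_set_scope.

Theorem proposition1p4 (R : realType) :
  (forall (a : lieAlgType R) (w : a -> a -> R),
     frobenius w -> realizable_dims w 2%N) /\
  (forall (a : lieAlgType R) (w : a -> a -> R),
     frobenius w ->
     (exists J : {vspace a}, is_ideal J /\ \dim J = 1%N) ->
     realizable_dims w = even_pos) /\
  (forall (a : lieAlgType R) (w : a -> a -> R),
     frobenius w ->
     forall k : nat, (2 <= k)%N -> (k ^ 2 < nu a)%N ->
     ~ realizable_dims w (2 * k)%N).
Proof.
split; [|split] => a w frob.
- by split; [exists 1%N | exact: realizable_2].
- move=> [J [idJ dJ]]; apply/seteqP; split => [d []//|_ [n n0 ->]].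
  by split; [exists n | exact: realizable_line_ideal idJ dJ].
move=> k k2 k2nu [_ [g [eta [xi [ds dq [f [f_bij f_lie f_om]]]]]]].
have [l [wl nd]] := frobenius_primitive frob.
have := realization_bound (real_complex R) wl nd ds f_bij f_lie f_om.
rewrite dq mul2n uphalf_double doubleK mulnn [(nu a <= _)%N]leqNgt k2nu.
have N2 : (2 < k.*2)%N by rewrite -mul2n; lia.
by move/(_ N2).
Qed.
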